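(* Let $N,K\ge1$, $n=NK$, let $C\in\mathbb{R}^{n\times n}$ be symmetric with $K\times K$ blocks $C^{(i,j)}$, $i,j=1,\dots,N$, and let $p_\star$ denote the optimal value of the Strong Perm-Synch SDP $$\min\{\mathrm{Tr}[CX]:\ X\in\mathbb{R}^{n\times n}\text{ symmetric},\ X^{(i,i)}=\tfrac1n\mathbf{I}_K\ (i=1,\dots,N),\ \mathrm{Tr}[X]=1,\ X\succeq0\}.$$ Let $\beta>0$, and suppose that $\boldsymbol\Lambda=(\Lambda^{(1)},\dots,\Lambda^{(N)})$, with $\Lambda^{(i)}\in\mathbb{R}^{K\times K}$ symmetric, is such that $$X_{\beta,\boldsymbol\Lambda}:=\frac{e^{-\beta(C-\bigoplus_{i=1}^N\Lambda^{(i)})}}{\mathrm{Tr}\big[e^{-\beta(C-\bigoplus_{i=1}^N\Lambda^{(i)})}\big]}$$ satisfies $\sum_{i=1}^N\big\|X_{\beta,\boldsymbol\Lambda}^{(i,i)}-\tfrac1n\mathbf{I}_K\big\|_{\mathrm{Tr}}\le\delta$. Then $$\big|\mathrm{Tr}[CX_{\beta,\boldsymbol\Lambda}]-p_\star\big|\le(2K+1)\,\delta\,|||C|||+\beta^{-1}\log n.$$ Moreover, one can efficiently construct $X'$ which is feasible for the Strong Perm-Synch SDP above and satisfies $$\mathrm{Tr}[CX']-p_\star\le(4K+2)\,\delta\,|||C|||+\beta^{-1}\log n.$$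
   Context: For an $NK\times NK$ matrix $A$, $A^{(i,j)}$ denotes its $(i,j)$ block of size $K\times K$, and $|||A|||:=\max_{i=1,\dots,N}\sum_{j=1}^N\|A^{(i,j)}\|_2$, where $\|\cdot\|_2$ is the spectral norm. $\|\cdot\|_{\mathrm{Tr}}$ is the nuclear norm (sum of singular values). $\bigoplus_{i=1}^N\Lambda^{(i)}$ is the block diagonal matrix with diagonal blocks $\Lambda^{(i)}$. *)

(* Defs.v *)
(* MathComp / MathComp-Analysis *)
From HB Require Import structures.
From mathcomp Require Import all_boot all_order all_algebra.
From mathcomp Require Import all_classical all_reals all_analysis.

Set Implicit Arguments.
Unset Strict Implicit.
Unset Printing Implicit Defensive.

Import Order.TTheory GRing.Theory Num.Theory.
Import numFieldNormedType.Exports.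

Local Open Scope classical_set_scope.
Local Open Scope ring_scope.

(* NK x NK matrices are taken over the index type 'I_(\sum_(i < N) K) of the
   block-matrix library, so that A^(i,j) is [submxblock A i j] and the direct
   sum of the Lambda^(i) is [\mxdiag_i Lambda i]. *)
Notation "''BM[' R ]_ ( N , K )" := 'M[R]_(\sum_(i < N) K)
  (at level 8, R at level 200, format "''BM[' R ]_ ( N ,  K )") : type_scope.

Notation "A ^( i , j )" := (submxblock A i j)
  (at level 2, i at level 200, j at level 200, format "A ^( i , j )")
  : ring_scope.

Section MatrixNotions.
Variable R : realType.

(* The power series is summed entrywise, which makes sense at any size. *)
Definition expmx (n : nat) (A : 'M[R]_n) : 'M[R]_n :=
  \matrix_(i, j)
    limn (fun m : nat => \sum_(k < m) (A ^+ k) i j / (k`!)%:R : R).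

(* Square roots of the eigenvalues of A^T A, with multiplicity. A list with
   the required property exists since A^T A is diagonalizable over R with
   nonnegative eigenvalues, and it is unique up to permutation. *)
Definition singular_values (m n : nat) (A : 'M[R]_(m, n)) : seq R :=
  [seq Num.sqrt x | x <- xget [::] [set s : seq R |
     char_poly (A^T *m A) = \prod_(x <- s) ('X - x%:P)]].

Definition spectral_norm (m n : nat) (A : 'M[R]_(m, n)) : R :=
  \big[Num.max/0]_(s <- singular_values A) s.

Definition nuclear_norm (m n : nat) (A : 'M[R]_(m, n)) : R :=
  \sum_(s <- singular_values A) s.

Definition block_norm (N K : nat) (A : 'BM[R]_(N, K)) : R :=
  \big[Num.max/0]_(i < N) \sum_(j < N) spectral_norm A^(i, j).

Definition psdmx (n : nat) (A : 'M[R]_n) : Prop :=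
  A^T = A /\ forall v : 'cV[R]_n, 0 <= (v^T *m A *m v) 0 0.

Definition feasible (N K : nat) (X : 'BM[R]_(N, K)) : Prop :=
  [/\ X^T = X,
      forall i : 'I_N, X^(i, i) = ((N * K)%:R^-1)%:M,
      \tr X = 1
    & psdmx X].

Definition opt_value (N K : nat) (C : 'BM[R]_(N, K)) : R :=
  inf [set \tr (C *m X) | X in [set X | feasible X]].

Definition gibbs (N K : nat) (C : 'BM[R]_(N, K)) (beta : R)
    (Lambda : 'I_N -> 'M[R]_K) : 'BM[R]_(N, K) :=
  let E := expmx (- beta *: (C - \mxdiag_i Lambda i)) in
  (\tr E)^-1 *: E.

End MatrixNotions.

(* A real RAM with exact arithmetic. Its memory consists of two-dimensional
   arrays of reals, addressed by an array name and two integer indices. *)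

Inductive iexp : Type :=
| IVar of nat
| ILit of nat
| IAdd of iexp & iexp
| ISub of iexp & iexp
| IMul of iexp & iexp.

Inductive rexp : Type :=
| RInt of iexp
| RCell of nat & iexp & iexp
| RAdd of rexp & rexp
| RSub of rexp & rexp
| RMul of rexp & rexp
| RDiv of rexp & rexp.

(* [For x e c] runs c for x = 0, ..., e - 1. Loops are the only binders of
   integer variables, and these bindings are local to the loop body; hence all
   integers met during a run are polynomially bounded in N and K. *)
Inductive cmd : Type :=
| Skip
| Seq of cmd & cmd
| Assign of nat & iexp & iexp & rexp
| For of nat & iexp & cmd
| IfIntLe of iexp & iexp & cmd & cmd
| IfRealLe of rexp & rexp & cmd & cmd.

Section Semantics.
Variable R : realType.

Definition memory := nat -> nat -> nat -> R.

Fixpoint ieval (env : nat -> nat) (e : iexp) : nat :=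
  match e with
  | IVar x => env x
  | ILit k => k
  | IAdd e1 e2 => (ieval env e1 + ieval env e2)%N
  | ISub e1 e2 => (ieval env e1 - ieval env e2)%N
  | IMul e1 e2 => (ieval env e1 * ieval env e2)%N
  end.

Fixpoint reval (env : nat -> nat) (mem : memory) (e : rexp) : R :=
  match e with
  | RInt k => (ieval env k)%:R
  | RCell a i j => mem a (ieval env i) (ieval env j)
  | RAdd e1 e2 => reval env mem e1 + reval env mem e2
  | RSub e1 e2 => reval env mem e1 - reval env mem e2
  | RMul e1 e2 => reval env mem e1 * reval env mem e2
  | RDiv e1 e2 => reval env mem e1 / reval env mem e2
  end.

Definition write (mem : memory) (a i j : nat) (v : R) : memory :=
  fun a' i' j' => if (a', i', j') == (a, i, j) then v else mem a' i' j'.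

(* The second component counts executed assignments, tests and loop
   iterations. The expressions occurring in a fixed program have bounded size,
   so this is the number of arithmetic operations up to a constant factor. *)
Fixpoint exec (c : cmd) (env : nat -> nat) (st : memory * nat) : memory * nat :=
  match c with
  | Skip => st
  | Seq c1 c2 => exec c2 env (exec c1 env st)
  | Assign a i j e =>
      (write st.1 a (ieval env i) (ieval env j) (reval env st.1 e), st.2.+1)
  | For x e c1 =>
      foldl (fun s k => exec c1 (fun y => if y == x then k else env y)
                             (s.1, s.2.+1))
            (st.1, st.2.+1) (iota 0 (ieval env e))
  | IfIntLe e1 e2 c1 c2 =>
      exec (if (ieval env e1 <= ieval env e2)%N then c1 else c2) env
           (st.1, st.2.+1)
  | IfRealLe e1 e2 c1 c2 =>
      exec (if reval env st.1 e1 <= reval env st.1 e2 then c1 else c2) env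
           (st.1, st.2.+1)
  end.

(* Initially, the integer variables 0 and 1 hold N and K, array 0 holds the
   input matrix, and everything else is zero. The output is read in array 1. *)
Definition init_env (N K : nat) : nat -> nat := nth 0%N [:: N; K].

Definition init_mem (n : nat) (X : 'M[R]_n) : memory :=
  fun a i j =>
    if a is 0%N then
      match insub i : option 'I_n, insub j : option 'I_n with
      | Some i', Some j' => X i' j'
      | _, _ => 0
      end
    else 0.

Definition run (P : cmd) (N K : nat) (X : 'BM[R]_(N, K)) : memory * nat :=
  exec P (init_env N K) (init_mem X, 0%N).

Definition output (P : cmd) (N K : nat) (X : 'BM[R]_(N, K)) : 'BM[R]_(N, K) :=
  \matrix_(i, j) (run P X).1 1%N i j.

Definition steps (P : cmd) (N K : nat) (X : 'BM[R]_(N, K)) : nat :=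
  (run P X).2.

Definition poly_time (P : cmd) : Prop :=
  exists c d : nat, forall (N K : nat) (X : 'BM[R]_(N, K)),
    (0 < N)%N -> (0 < K)%N -> (steps P X <= c * (N * K) ^ d)%N.

End Semantics.

(* Main.v *)
Require Import Defs.
From HB Require Import structures.
From mathcomp Require Import all_boot all_order all_algebra.
From mathcomp Require Import all_classical all_reals all_analysis.
From mathcomp Require Import complex zify ring lra.

Set Implicit Arguments.
Unset Strict Implicit.
Unset Printing Implicit Defensive.

Import Order.TTheory GRing.Theory Num.Theory.
Import numFieldNormedType.Exports.

Local Open Scope ring_scope.

(* Write n = NK, D_i = X^(i,i) - I/n and d_i for the nuclear norm of D_i. Given
   a psd Y and weights s_i in [0,1], replacing Y^(i,j) by s_i s_j Y^(i,j) for
   i <> j and Y^(i,i) by T_i preserves positivity as soon as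
   T_i - s_i^2 Y^(i,i) is psd. If 1 - s_i <= n d_i, this moves Tr[CY] by at most
   (2K+1) (sum_i d_i) |||C|||, because
   |Tr(C^(i,j) Y^(j,i))| <= ||C^(i,j)|| (Tr Y^(i,i) + Tr Y^(j,j)) / 2.
   It is used twice: from X to a feasible point (T_i = I/n), and from a feasible
   Y to a matrix with the diagonal blocks of X (s_i = max(0, 1 - n d_i)). In
   the second case the Lambda-terms cancel, and the Gibbs matrix beats any such
   matrix up to its entropy, that is up to log n / beta.
   For the algorithm, s_i = 1/(1+z_i) works whenever
   n ||D_i||_F / 2 <= z_i <= n d_i. As the Frobenius norm is at most the nuclear
   norm, an approximation of it within a factor 2 suffices, and such an
   approximation is found without square roots. *)

(** * Spectral theorem for real symmetric matrices *)

(** The algebraically closed field [R[i]] provides an eigenvalue [a] with a left eigenvector [v].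
    The conjugate transpose [vc] of [v] is a right eigenvector for the conjugate of [a]. Evaluating
    [v A vc] from both sides, with [v vc] nonzero, shows that [a] is real, hence a root of the real
    characteristic polynomial. *)
Lemma sym_eigenvalue (R : rcfType) n (A : 'M[R]_n) : (0 < n)%N -> A^T = A ->
  exists a, eigenvalue A a.
Proof.
move=> n0 As.
pose f := real_complex R.
have [a /eigenvalueP [v vA v0]] := eigenvalue_closed (map_mx f A) n0.
have fc (x : R) : (f x)^* = f x by rewrite conj_Creal // complex_real.
have aR : a^* = a.
  pose vc := (map_mx Num.conj v)^T.
  have Avc : map_mx f A *m vc = a^* *: vc.
    apply: trmx_inj; rewrite trmx_mul trmxK linearZ /= trmxK -map_mxZ.
    rewrite -vA map_mxM map_trmx As; congr (_ *m _).
    by apply/matrixP => i j; rewrite !mxE; exact/esym/fc.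
  have vv : (v *m vc) 0 0 != 0.
    rewrite mxE psumr_neq0; last by move=> i _; rewrite !mxE mul_conjC_ge0.
    apply/hasP; case/rV0Pn: v0 => i vi; exists i; first exact: mem_index_enum.
    by rewrite /= !mxE mul_conjC_gt0.
  apply: (mulIf vv).
  have : (v *m map_mx f A *m vc) 0 0 = (a *: (v *m vc)) 0 0.
    by rewrite vA scalemxAl.
  rewrite -mulmxA Avc -scalemxAr.
  have sc c (M : 'M[R[i]%C]_1) : (c *: M) 0 0 = c * M 0 0 by rewrite mxE.
  by rewrite !sc.
have [b ab] : exists b, a = f b.
  by exists (complex.Re a); apply/esym; rewrite /f RRe_real // CrealE aR.
exists b; rewrite eigenvalue_root_char.
have : eigenvalue (map_mx f A) (f b).
  by rewrite -ab; apply/eigenvalueP; exists v.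
by rewrite eigenvalue_root_char -map_char_poly fmorph_root.
Qed.

Lemma mul_mxtr_rowE (R : pzRingType) n (u : 'rV[R]_n) :
  (u *m u^T) 0 0 = \sum_i u 0 i ^+ 2.
Proof. by rewrite mxE; apply: eq_bigr => i _; rewrite [u^T _ _]mxE. Qed.

(** The reflection in the hyperplane orthogonal to [v - e] exchanges the unit vectors [e] and [v].
    It serves to move the first basis vector onto a unit eigenvector. *)
Lemma householder (R : realFieldType) n (e v : 'rV[R]_n) :
  e *m e^T = 1%:M -> v *m v^T = 1%:M ->
  exists H : 'M[R]_n, [/\ H^T = H, H *m H = 1%:M & e *m H = v].
Proof.
move=> ee vv; pose w := v - e; pose q := (w *m w^T) 0 0; pose c := 2%:R / q.
(* If w = 0 then c = 2 / 0 = 0 and the reflection is the identity. *)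
exists (1%:M - c *: (w^T *m w)).
have qE : w *m w^T = q%:M by rewrite [LHS]mx11_scalar.
have ev : v *m e^T = e *m v^T.
  by apply/matrixP => i j; rewrite !ord1 -[in RHS](trmxK e) -trmx_mul !mxE.
(* Unit length gives [q = 2 - 2 <e,v>], so [<e,w> = <e,v> - 1 = - q / 2]. Since [c = 2 / q], the
   reflection then sends [e] to [e + w = v]. *)
have qE2 : e *m w^T = (- q / 2%:R)%:M.
  suff -> : q = 2%:R - 2%:R * (e *m v^T) 0 0.
    have -> : e *m w^T = e *m v^T - 1%:M by rewrite linearB /= mulmxBr ee.
    rewrite [e *m v^T]mx11_scalar; apply/matrixP => i j.
    by rewrite !ord1 !mxE /= !mulr1n; field.
  rewrite /q linearB /= mulmxBr !mulmxBl ee vv ev.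
  have : forall M : 'M[R]_1, (1%:M - M - (M - 1%:M)) 0 0 = 2%:R - 2%:R * M 0 0.
    by move=> M; rewrite !mxE /= mulr1n; ring.
  exact.
have q0 : q = 0 -> w = 0.
  rewrite /q mul_mxtr_rowE => /eqP; rewrite psumr_eq0; last first.
    by move=> i _; rewrite sqr_ge0.
  move=> /allP h; apply/rowP => i; rewrite [RHS]mxE; apply/eqP.
  by have := h i (mem_index_enum _); rewrite sqrf_eq0.
split.
- by rewrite linearB /= linearZ /= trmx_mul trmxK trmx1.
- rewrite mulmxBr mulmx1 mulmxBl mul1mx -scalemxAr -scalemxAl.
  rewrite mulmxA -(mulmxA w^T w) qE mul_mx_scalar -scalemxAl.
  have [/q0 ->|qn0] := eqVneq q 0; first by rewrite mulmx0 !scaler0 !subr0.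
  suff -> : c *: (w^T *m w) - c *: (c *: (q *: (w^T *m w)))
      = - (c *: (w^T *m w)).
    by rewrite opprK subrK.
  rewrite !scalerA (_ : c * c * q = c + c); last by rewrite /c; field.
  by rewrite scalerDl opprD addrA subrr add0r.
- rewrite mulmxBr mulmx1 -scalemxAr mulmxA qE2 mul_scalar_mx scalerA.
  have [q00|qn0] := eqVneq q 0.
    rewrite q00 oppr0 mul0r mulr0 scale0r subr0; apply/eqP.
    by rewrite eq_sym -subr_eq0 -/w q0.
  rewrite (_ : c * _ = -1); last by rewrite /c; field.
  by rewrite scaleN1r opprK /w addrC subrK.
Qed.

(** Deflation, by induction on the size. Conjugating by a reflection that maps the first basis
    vector [e] to a unit eigenvector makes the first row of the matrix equal to [a e]. By symmetry
    the first column has the same shape, and the induction hypothesis applies to the remaining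
    block. The rows of [P] are the eigenvectors. *)
Lemma sym_spectral (R : rcfType) n (A : 'M[R]_n) : A^T = A ->
  exists (P : 'M[R]_n) (d : 'rV[R]_n),
    P *m P^T = 1%:M /\ A = P^T *m diag_mx d *m P.
Proof.
elim: n A => [|n IH] A As.
  by exists 1%:M, 0; split; apply/matrixP => -[].
have [a /eigenvalueP [u uA u0]] := sym_eigenvalue (ltn0Sn n) As.
pose r := (u *m u^T) 0 0.
have r0 : 0 < r.
  rewrite /r mul_mxtr_rowE; case/rV0Pn: u0 => i ui.
  rewrite (bigD1 i) //= ltr_wpDr ?exprn_even_gt0 //.
  by apply: sumr_ge0 => j _; rewrite sqr_ge0.
pose v := (Num.sqrt r)^-1 *: u.
have vv : v *m v^T = 1%:M.
  rewrite /v linearZ /= -scalemxAr -scalemxAl scalerA [u *m _]mx11_scalar -/r.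
  rewrite -invfM -expr2 sqr_sqrtr ?ltW // scale_scalar_mx mulVf //.
  by rewrite gt_eqF.
have vA : v *m A = a *: v.
  by rewrite /v -scalemxAl uA !scalerA mulrC.
pose e : 'rV[R]_(1 + n) := row_mx 1%:M 0.
have ee : e *m e^T = 1%:M.
  by rewrite /e tr_row_mx mul_row_col trmx1 mul1mx trmx0 mulmx0 addr0.
have [H [Hs HH eH]] := householder ee vv.
pose B : 'M[R]_(1 + n) := H *m A *m H.
have Bs : B^T = B by rewrite /B !trmx_mul As Hs mulmxA.
have eB : e *m B = a *: e.
  by rewrite /B !mulmxA eH vA -scalemxAl -eH -mulmxA HH mulmx1.
have BE : B = block_mx a%:M 0 0 (drsubmx B).
  have eu : usubmx B = row_mx a%:M 0.
    rewrite -[LHS]mul1mx -[B in LHS]vsubmxK col_mxKu.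
    transitivity (e *m B); last by rewrite eB scale_row_mx scaler0 scalemx1.
    by rewrite -{2}[B]vsubmxK mul_row_col mul0mx addr0.
  have ul : ulsubmx B = a%:M by rewrite /ulsubmx eu row_mxKl.
  have ur : ursubmx B = 0 by rewrite /ursubmx eu row_mxKr.
  have dl : dlsubmx B = 0 by rewrite -Bs -trmx_ursub ur trmx0.
  by rewrite -{1}[B]submxK ul ur dl.
have [Q [d [QQ DE]]] : exists (P : 'M[R]_n) (d : 'rV[R]_n),
    P *m P^T = 1%:M /\ drsubmx B = P^T *m diag_mx d *m P.
  by apply: IH; rewrite trmx_drsub Bs.
pose S : 'M[R]_(1 + n) := block_mx 1%:M 0 0 Q.
have ST : S^T = block_mx 1%:M 0 0 Q^T.
  by rewrite /S tr_block_mx trmx1 !trmx0.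
have SS : S *m S^T = 1%:M.
  rewrite ST /S mulmx_block !mul1mx !mulmx0 !mul0mx !addr0 !add0r QQ.
  by rewrite -scalar_mx_block.
have BS : B = S^T *m diag_mx (row_mx a%:M d) *m S.
  rewrite ST /S diag_mx_row !mulmx_block !mul1mx !mulmx0 !mul0mx !addr0 !add0r.
  rewrite mulmx1 BE DE; congr (block_mx _ _ _ _); rewrite ?mul0mx //.
  by apply/matrixP => i j; rewrite !ord1 !mxE /= !mulr1n.
exists (S *m H), (row_mx a%:M d); split.
  by rewrite trmx_mul Hs mulmxA -(mulmxA S) HH mulmx1.
rewrite trmx_mul Hs !mulmxA -2!(mulmxA H) -BS.
by rewrite /B !mulmxA HH mul1mx -mulmxA HH mulmx1.
Qed.

(** * Spectral and nuclear norms *)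

Lemma char_poly_spectral (R : comNzRingType) n (P : 'M[R]_n) (d : 'rV[R]_n) :
  P *m P^T = 1%:M ->
  char_poly (P^T *m diag_mx d *m P) = \prod_i ('X - (d 0 i)%:P).
Proof.
move=> /mulmx1C PP; pose f := @map_mx _ _ (@polyC R) n n.
have fPP : f P^T *m f P = 1%:M by rewrite /f -map_mxM PP map_mx1.
have -> : char_poly (P^T *m diag_mx d *m P) = char_poly (diag_mx d).
  have E : char_poly_mx (P^T *m diag_mx d *m P)
      = f P^T *m char_poly_mx (diag_mx d) *m f P.
    rewrite /char_poly_mx !map_mxM mulmxBr mulmxBl; congr (_ - _).
    by rewrite mul_mx_scalar -scalemxAl fPP scalemx1.
  rewrite /char_poly E !det_mulmx mulrAC -det_mulmx fPP det1 mul1r //.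
rewrite char_poly_trig; last by rewrite diag_mx_is_trig.
by apply: eq_bigr => i _; rewrite mxE eqxx mulr1n.
Qed.

Lemma quad_spectral (R : comNzRingType) n (P : 'M[R]_n) (d : 'rV[R]_n)
    (v : 'rV[R]_n) :
  (v *m (P^T *m diag_mx d *m P) *m v^T) 0 0 =
  \sum_i d 0 i * (v *m P^T) 0 i ^+ 2.
Proof.
rewrite !mulmxA -(mulmxA _ P).
have -> : P *m v^T = (v *m P^T)^T by rewrite trmx_mul trmxK.
rewrite mxE.
apply: eq_bigr => i _; rewrite mul_mx_diag [(v *m P^T)^T _ _]mxE [_ 0 i]mxE.
by rewrite mulrAC mulrC expr2.
Qed.

Lemma sqnorm_orthogonal (R : comNzRingType) n (P : 'M[R]_n) (v : 'rV[R]_n) :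
  P *m P^T = 1%:M -> \sum_i (v *m P^T) 0 i ^+ 2 = \sum_i v 0 i ^+ 2.
Proof.
move=> /mulmx1C PP; rewrite -!mul_mxtr_rowE trmx_mul trmxK mulmxA.
by rewrite -(mulmxA v) PP mulmx1.
Qed.

Lemma psd_spectral_ge0 (R : realType) n (P : 'M[R]_n) (d : 'rV[R]_n) i :
  P *m P^T = 1%:M -> psdmx (P^T *m diag_mx d *m P) -> 0 <= d 0 i.
Proof.
move=> PP [_ /(_ ((row i P)^T))]; rewrite trmxK quad_spectral.
rewrite -row_mul PP (bigD1 i) //= big1 => [|j /negPf ji].
  by rewrite !mxE eqxx mulr1n expr1n mulr1 addr0.
by rewrite !mxE eq_sym ji expr0n /= mulr0.
Qed.

Lemma spectral_psd (R : realType) n (P : 'M[R]_n) (d : 'rV[R]_n) :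
  (forall i, 0 <= d 0 i) -> psdmx (P^T *m diag_mx d *m P).
Proof.
move=> d0; split; first by rewrite !trmx_mul trmxK tr_diag_mx mulmxA.
move=> v; rewrite -{2}[v]trmxK quad_spectral.
by apply: sumr_ge0 => i _; rewrite mulr_ge0 ?sqr_ge0.
Qed.

Lemma psd_gram (R : realType) m n (A : 'M[R]_(m, n)) : psdmx (A^T *m A).
Proof.
split=> [|v]; first by rewrite trmx_mul trmxK.
rewrite mulmxA -(mulmxA _ A) -trmx_mul -{2}[A *m v]trmxK mul_mxtr_rowE.
by apply: sumr_ge0 => i _; rewrite sqr_ge0.
Qed.

Lemma psd_factor (R : realType) n (X : 'M[R]_n) :
  psdmx X -> exists W : 'M[R]_n, X = W^T *m W.
Proof.
move=> Xp; have [P [d [PP XE]]] := sym_spectral Xp.1.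
have d0 i : 0 <= d 0 i by apply: (psd_spectral_ge0 i PP); rewrite -XE.
exists (diag_mx (map_mx Num.sqrt d) *m P).
rewrite trmx_mul tr_diag_mx mulmxA -(mulmxA P^T) mulmx_diag XE.
congr (_ *m diag_mx _ *m _); apply/rowP => i.
by rewrite !mxE -expr2 sqr_sqrtr.
Qed.

(** A product of monic linear factors determines its roots up to order. Any orthogonal
    diagonalization therefore computes the list chosen by [xget], and also shows that the default
    [[::]] is not chosen for want of a candidate. *)
Lemma singular_values_spectral (R : realType) m n (A : 'M[R]_(m, n))
    (P : 'M[R]_n) (d : 'rV[R]_n) :
  P *m P^T = 1%:M -> A^T *m A = P^T *m diag_mx d *m P ->
  perm_eq (singular_values A) [seq Num.sqrt (d 0 i) | i <- index_enum 'I_n].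
Proof.
move=> PP AE; rewrite /singular_values [X in perm_eq _ X](map_comp Num.sqrt).
apply: perm_map; apply: prod_XsubC_eq.
case: xgetP => [s _ <-|/(_ [seq d 0 i | i <- index_enum 'I_n])] /=.
  by rewrite AE char_poly_spectral // big_map.
by case; rewrite AE char_poly_spectral // big_map.
Qed.

Lemma nuclear_norm_spectral (R : realType) n (P : 'M[R]_n) (d : 'rV[R]_n) :
  P *m P^T = 1%:M ->
  nuclear_norm (P^T *m diag_mx d *m P) = \sum_i `|d 0 i|.
Proof.
move=> PP; pose e : 'rV[R]_n := \row_i (d 0 i ^+ 2).
have DE : (P^T *m diag_mx d *m P)^T *m (P^T *m diag_mx d *m P)
    = P^T *m diag_mx e *m P.
  rewrite !trmx_mul trmxK tr_diag_mx !mulmxA -(mulmxA _ P) PP mulmx1.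
  by rewrite -(mulmxA _ (diag_mx d) (diag_mx d)) mulmx_diag.
rewrite /nuclear_norm (perm_big _ (singular_values_spectral PP DE)) /= big_map.
by apply: eq_bigr => i _; rewrite mxE sqrtr_sqr.
Qed.

Lemma spectral_norm_ge0 (R : realType) m n (A : 'M[R]_(m, n)) :
  0 <= spectral_norm A.
Proof. exact: bigmax_ge_id. Qed.

Lemma nuclear_norm_ge0 (R : realType) m n (A : 'M[R]_(m, n)) :
  0 <= nuclear_norm A.
Proof.
by rewrite /nuclear_norm big_map sumr_ge0 // => x _; rewrite sqrtr_ge0.
Qed.

Lemma block_norm_ge0 (R : realType) N K (A : 'BM[R]_(N, K)) : 0 <= block_norm A.
Proof. exact: bigmax_ge_id. Qed.

Lemma spectral_norm_sq (R : realType) m n (A : 'M[R]_(m, n)) (v : 'rV[R]_n) :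
  \sum_i (v *m A^T) 0 i ^+ 2 <= spectral_norm A ^+ 2 * \sum_i v 0 i ^+ 2.
Proof.
have Ap := psd_gram A; have [P [d [PP AE]]] := sym_spectral Ap.1.
have d0 i : 0 <= d 0 i by apply: (psd_spectral_ge0 i PP); rewrite -AE.
have ds i : d 0 i <= spectral_norm A ^+ 2.
  rewrite -[d 0 i]sqr_sqrtr // lerXn2r ?nnegrE ?sqrtr_ge0 ?spectral_norm_ge0 //.
  apply: (@le_bigmax_seq _ _ _ _ 0 (Num.sqrt (d 0 i)) xpredT id) => //.
  rewrite (perm_mem (singular_values_spectral PP AE)).
  by apply: map_f; exact: mem_index_enum.
rewrite -mul_mxtr_rowE trmx_mul trmxK mulmxA -(mulmxA v) AE quad_spectral.
rewrite -(sqnorm_orthogonal v PP) mulr_sumr; apply: ler_sum => i _.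
by rewrite ler_wpM2r ?sqr_ge0.
Qed.

(** Cauchy-Schwarz followed by the arithmetic-geometric inequality. The additive right-hand side can
    be summed over the rows of a factor of a psd matrix, where it becomes a sum of traces. *)
Lemma spectral_norm_bilin (R : realType) m n (A : 'M[R]_(m, n))
    (u : 'rV[R]_m) (v : 'rV[R]_n) :
  `|(u *m A *m v^T) 0 0| <=
  spectral_norm A * (\sum_i u 0 i ^+ 2 + \sum_i v 0 i ^+ 2) / 2%:R.
Proof.
have := spectral_norm_sq A v; have := spectral_norm_ge0 A.
set s := spectral_norm A; set Q := \sum_i v 0 i ^+ 2 => s0.
pose y := v *m A^T; rewrite -/y => yQ.
have -> : (u *m A *m v^T) 0 0 = \sum_i u 0 i * y 0 i.
  rewrite -mulmxA -{1}[A]trmxK -trmx_mul mxE.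
  by apply: eq_bigr => i _; rewrite [y^T _ _]mxE.
(* The weighted inequality [2 a b <= s a^2 + b^2 / s] used below divides by [s]. If [s = 0], the
   vector [y] vanishes. *)
move: s0; rewrite le_eqVlt => /predU1P[s0|s0].
  move: yQ; rewrite -s0 expr0n /= mul0r => yQ.
  have y0 i : y 0 i = 0.
    apply/eqP; rewrite -sqrf_eq0 eq_le sqr_ge0 andbT (le_trans _ yQ) //.
    by rewrite (bigD1 i) //= lerDl sumr_ge0 // => j _; rewrite sqr_ge0.
  by rewrite big1 ?normr0 ?mul0r // => i _; rewrite y0 mulr0.
apply: le_trans (ler_norm_sum _ _ _) _.
suff : \sum_i `|u 0 i * y 0 i|
    <= (s * \sum_i u 0 i ^+ 2 + s^-1 * \sum_i y 0 i ^+ 2) / 2%:R.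
  move/le_trans; apply; rewrite ler_pM2r ?invr_gt0 // mulrDr lerD2l.
  by rewrite mulrC ler_pdivrMr // mulrC mulrA -expr2.
rewrite !mulr_sumr -big_split /= mulr_suml; apply: ler_sum => i _.
rewrite normrM; set a := `|u 0 i|; set b := `|y 0 i|.
have -> : u 0 i ^+ 2 = a ^+ 2 by rewrite /a real_normK ?num_real.
have -> : y 0 i ^+ 2 = b ^+ 2 by rewrite /b real_normK ?num_real.
have : 0 <= s^-1 * (s * a - b) ^+ 2 by rewrite mulr_ge0 ?sqr_ge0 ?invr_ge0 ?ltW.
have -> : s^-1 * (s * a - b) ^+ 2 = s * a ^+ 2 + s^-1 * b ^+ 2 - 2%:R * a * b.
  by field; rewrite gt_eqF.
lra.
Qed.

(** With [X = W^T W], a submatrix of [X] is a product of two column selections of [W]. The trace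
    then splits into one bilinear form for each row of [W]. Taking for [f] and [g] the index maps of
    two blocks controls an off-diagonal block by two diagonal ones. *)
Lemma trace_mul_mxsub (R : realType) n K (A : 'M[R]_K) (X : 'M[R]_n)
    (f g : 'I_K -> 'I_n) :
  psdmx X ->
  `|\tr (A *m mxsub f g X)| <=
  spectral_norm A * (\tr (mxsub f f X) + \tr (mxsub g g X)) / 2%:R.
Proof.
move=> /psd_factor [W ->].
have sub h k : mxsub h k (W^T *m W) = (colsub h W)^T *m colsub k W.
  by apply/matrixP => i j; rewrite !mxE; apply: eq_bigr => l _; rewrite !mxE.
have trE (B : 'M[R]_(n, K)) : \tr (B^T *m B) = \sum_l \sum_i (row l B) 0 i ^+ 2.
  rewrite mxtrace_mulC; apply: eq_bigr => l _.
  by rewrite mxE; apply: eq_bigr => i _; rewrite !mxE.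
rewrite !sub !trE mulmxA mxtrace_mulC mulmxA.
apply: le_trans (ler_norm_sum _ _ _) _.
rewrite -big_split /= mulr_sumr mulr_suml; apply: ler_sum => l _.
rewrite addrC.
suff -> : (colsub g W *m A *m (colsub f W)^T) l l =
   (row l (colsub g W) *m A *m (row l (colsub f W))^T) 0 0.
  exact: spectral_norm_bilin.
by rewrite -row_mul !mxE; apply: eq_bigr => j _; rewrite !mxE.
Qed.

(** In an orthonormal eigenbasis of [D] the trace is the sum of the eigenvalues of [D] weighted by
    values of the quadratic form of [A] at unit vectors. Each such value is at most the spectral
    norm. *)
Lemma trace_mul_sym (R : realType) K (A D : 'M[R]_K) : D^T = D ->
  `|\tr (A *m D)| <= spectral_norm A * nuclear_norm D.
Proof.
move=> Ds; have [P [d [PP ->]]] := sym_spectral Ds.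
rewrite nuclear_norm_spectral //.
rewrite !mulmxA mxtrace_mulC !mulmxA mul_mx_diag /mxtrace mulr_sumr.
apply: le_trans (ler_norm_sum _ _ _) _; apply: ler_sum => i _.
rewrite mxE normrM ler_wpM2r //.
suff -> : (P *m A *m P^T) i i = (row i P *m A *m (row i P)^T) 0 0.
  apply: le_trans (spectral_norm_bilin _ _ _) _.
  have -> : \sum_j row i P 0 j ^+ 2 = 1.
    transitivity ((P *m P^T) i i); last by rewrite PP mxE eqxx.
    by rewrite mxE; apply: eq_bigr => j _; rewrite !mxE expr2.
  by rewrite -mulrA; lra.
by rewrite -row_mul !mxE; apply: eq_bigr => j _; rewrite !mxE.
Qed.

(** * Rescaling the blocks of a psd matrix *)

Lemma psd_congr (R : realType) m n (M : 'M[R]_(m, n)) (A : 'M[R]_m) :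
  psdmx A -> psdmx (M^T *m A *m M).
Proof.
case=> As A0; split=> [|v]; first by rewrite !trmx_mul trmxK As mulmxA.
by have := A0 (M *m v); rewrite trmx_mul !mulmxA.
Qed.

Lemma psdD (R : realType) n (A B : 'M[R]_n) :
  psdmx A -> psdmx B -> psdmx (A + B).
Proof.
move=> [As A0] [Bs B0]; split=> [|v]; first by rewrite linearD /= As Bs.
by rewrite mulmxDr mulmxDl mxE addr_ge0.
Qed.

Lemma psd_mxdiag (R : realType) N K (B : 'I_N -> 'M[R]_K) :
  (forall i, psdmx (B i)) -> psdmx (\mxdiag_i B i).
Proof.
move=> Bp; split=> [|v].
  by rewrite tr_mxdiag; apply: eq_mxdiag => i; case: (Bp i).
rewrite -[v]submxcolK tr_mxcol mul_mxrow_mxdiag mul_mxrow_mxcol.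
by rewrite summxE; apply: sumr_ge0 => i _; case: (Bp i).
Qed.

Lemma trace_mul_block (R : realType) N K (A B : 'BM[R]_(N, K)) :
  \tr (A *m B) = \sum_i \sum_j \tr (A^(i, j) *m B^(j, i)).
Proof.
rewrite -{1}[A]submxblockK -{1}[B]submxblockK mul_mxblock mxtrace_mxblock.
by apply: eq_bigr => i _; rewrite linear_sum.
Qed.

Lemma trace_block (R : realType) N K (A : 'BM[R]_(N, K)) :
  \tr A = \sum_i \tr A^(i, i).
Proof. by rewrite -{1}[A]submxblockK mxtrace_mxblock. Qed.

Definition round_blocks (R : realType) N K (s : 'I_N -> R) (T : 'I_N -> 'M[R]_K)
    (Y : 'BM[R]_(N, K)) : 'BM[R]_(N, K) :=
  \mxblock_(i, j) (if i == j then T i else (s i * s j) *: Y^(i, j)).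

Lemma round_blocks_diag (R : realType) N K (s : 'I_N -> R)
    (T : 'I_N -> 'M[R]_K) (Y : 'BM[R]_(N, K)) i :
  (round_blocks s T Y)^(i, i) = T i.
Proof. by rewrite mxblockK eqxx. Qed.

(** The rounded matrix is the congruence of [Y] by the block diagonal matrix of the [s i], plus the
    block diagonal correction [T i - s i ^+ 2 *: Y^(i, i)]. *)
Lemma round_blocks_psd (R : realType) N K (s : 'I_N -> R)
    (T : 'I_N -> 'M[R]_K) (Y : 'BM[R]_(N, K)) :
  psdmx Y -> (forall i, psdmx (T i - s i ^+ 2 *: Y^(i, i))) ->
  psdmx (round_blocks s T Y).
Proof.
move=> Yp Tp.
pose S : 'BM[R]_(N, K) := \mxdiag_i (s i)%:M.
suff -> : round_blocks s T Y =
    S^T *m Y *m S + \mxdiag_i (T i - s i ^+ 2 *: Y^(i, i)).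
  by apply: psdD; [exact: psd_congr | exact: psd_mxdiag].
have -> : S^T = S.
  by rewrite tr_mxdiag; apply: eq_mxdiag => i; rewrite tr_scalar_mx.
rewrite -{2}[Y]submxblockK mul_mxdiag_mxblock mul_mxblock_mxdiag.
rewrite /mxdiag -mxblockD; apply: eq_mxblock => i j.
rewrite mul_scalar_mx mul_mx_scalar scalerA.
case: eqVneq => [<-|_]; last by rewrite addr0 mulrC.
by rewrite conform_mx_id -expr2 addrC subrK.
Qed.

(** Both roundings are instances, so the diagonal blocks enter only through their traces and their
    change. The error of a pair of blocks is charged to the two block rows separately, because
    [block_norm] bounds row sums. *)
Lemma round_blocks_cost (R : realType) N K (n : R) (s d : 'I_N -> R)
    (T : 'I_N -> 'M[R]_K) (C Y : 'BM[R]_(N, K)) :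
  0 < n -> C^T = C -> psdmx Y ->
  (forall i, 0 <= s i <= 1) -> (forall i, 0 <= d i) ->
  (forall i, 1 - s i <= n * d i) ->
  (forall i, \tr Y^(i, i) <= K%:R / n + d i) ->
  (forall i, `|\tr (C^(i, i) *m (T i - Y^(i, i)))|
     <= spectral_norm C^(i, i) * d i) ->
  `|\tr (C *m round_blocks s T Y) - \tr (C *m Y)|
    <= (2 * K + 1)%:R * (\sum_i d i) * block_norm C.
Proof.
move=> n0 Cs Yp s01 d0 sd tY diag.
(* The summand [K d_i] is [n d_i] times the ideal trace [K / n]. The half comes from averaging the
   trace excesses of two blocks. Twice [w i] gives the factor [2 K + 1]. *)
pose w i := (K%:R + 2%:R^-1) * d i.
pose c i j := spectral_norm C^(i, j).
have w0 i : 0 <= w i by rewrite mulr_ge0.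
have off i j : `|(s j * s i - 1) * \tr (C^(i, j) *m Y^(j, i))|
    <= c i j * w i + c j i * w j.
  pose t := (\tr Y^(i, i) + \tr Y^(j, j)) / 2%:R.
  have t1 : `|\tr (C^(i, j) *m Y^(j, i))| <= c i j * t.
    by rewrite /t mulrA [_ + \tr _]addrC; exact: trace_mul_mxsub.
  have t2 : `|\tr (C^(i, j) *m Y^(j, i))| <= c j i * t.
    rewrite -mxtrace_tr trmx_mul !tr_submxblock Cs Yp.1 mxtrace_mulC.
    by rewrite /t mulrA; exact: trace_mul_mxsub.
  have [/andP[si0 si1] /andP[sj0 sj1]] := (s01 i, s01 j).
  have ss : 0 <= 1 - s j * s i by rewrite subr_ge0 mulr_ile1.
  (* On the part [K / n] of [t] the factor [1 - s j * s i] is bounded by [n (d i + d j)]. On the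
     part [(d i + d j) / 2] it is bounded by 1. *)
  have st : (1 - s j * s i) * t <= w i + w j.
    have tle : t <= K%:R / n + (d i + d j) / 2%:R.
      by have := tY i; have := tY j; rewrite /t; lra.
    apply: le_trans (ler_wpM2l ss tle) _; rewrite mulrDr.
    have -> : w i + w j = K%:R * (d i + d j) + (d i + d j) / 2%:R.
      by rewrite /w; field.
    apply: lerD; last first.
      apply: ler_piMl; first by rewrite divr_ge0 // addr_ge0.
      by rewrite lerBlDr lerDl mulr_ge0.
    rewrite mulrA ler_pdivrMr // mulrC -mulrA ler_wpM2l //.
    have -> : 1 - s j * s i = (1 - s i) + (1 - s j) - (1 - s i) * (1 - s j).
      by ring.
    rewrite lerBlDr (mulrC _ n) mulrDr -[leLHS]addr0 lerD //; first exact: lerD.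
    by rewrite mulr_ge0 ?subr_ge0.
  rewrite normrM distrC (ger0_norm ss).
  (* Starting from the smaller of the two norms, the share of [w i] can be charged to [c i j] and
     that of [w j] to [c j i], each within its own block row. *)
  have [cij|cji] := leP (c i j) (c j i).
    apply: le_trans (ler_wpM2l ss t1) _; rewrite mulrCA.
    apply: le_trans (ler_wpM2l (spectral_norm_ge0 _) st) _.
    by rewrite mulrDr lerD2l ler_wpM2r.
  apply: le_trans (ler_wpM2l ss t2) _; rewrite mulrCA.
  apply: le_trans (ler_wpM2l (spectral_norm_ge0 _) st) _.
  by rewrite mulrDr lerD2r ler_wpM2r // ltW.
rewrite -raddfB /= -mulmxBr trace_mul_block.
apply: (@le_trans _ _ (\sum_i \sum_j (c i j * w i + c j i * w j))).
  apply: le_trans (ler_norm_sum _ _ _) _; apply: ler_sum => i _.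
  apply: le_trans (ler_norm_sum _ _ _) _; apply: ler_sum => j _.
  rewrite submxblockB mxblockK.
  have [->|ji] := eqVneq j i; last first.
    rewrite -{2}[Y^(j, i)]scale1r -scalerBl -scalemxAr mxtraceZ.
    exact: off.
  apply: le_trans (diag i) _; rewrite -/(c i i) -mulrDr.
  rewrite ler_wpM2l ?spectral_norm_ge0 // /w.
  have : 0 <= K%:R * d i by rewrite mulr_ge0.
  lra.
have -> : \sum_i \sum_j (c i j * w i + c j i * w j)
    = 2%:R * \sum_i w i * \sum_j c i j.
  under eq_bigr do rewrite big_split /=.
  rewrite big_split /= [X in _ + X]exchange_big /= mulr_natl mulr2n.
  congr (_ + _); apply: eq_bigr => i _; rewrite mulr_sumr;
    by apply: eq_bigr => j _; rewrite mulrC.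
have -> : (2 * K + 1)%:R * (\sum_i d i) * block_norm C
    = 2%:R * \sum_i w i * block_norm C.
  by rewrite -mulr_suml -mulr_sumr natrD natrM; field.
rewrite ler_wpM2l //; apply: ler_sum => i _; rewrite ler_wpM2l //.
exact: (le_bigmax _ (fun i => \sum_j c i j)).
Qed.

(** * The Gibbs matrix *)

Lemma trace_spectral (R : comNzRingType) n (P : 'M[R]_n) (d : 'rV[R]_n) :
  P *m P^T = 1%:M -> \tr (P^T *m diag_mx d *m P) = \sum_i d 0 i.
Proof. by move=> PP; rewrite mxtrace_mulC mulmxA PP mul1mx mxtrace_diag. Qed.

Lemma expr_spectral (R : comNzRingType) n (P : 'M[R]_n) (d : 'rV[R]_n) k :
  P *m P^T = 1%:M ->
  (P^T *m diag_mx d *m P) ^+ k = P^T *m diag_mx (\row_i d 0 i ^+ k) *m P.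
Proof.
move=> PP; elim: k => [|k IH].
  have -> : \row_i d 0 i ^+ 0 = const_mx 1 by apply/rowP => i; rewrite !mxE.
  by rewrite diag_const_mx mulmx1 expr0 (mulmx1C PP).
rewrite exprS IH -[LHS]/(_ *m _) !mulmxA -(mulmxA _ P) PP mulmx1.
rewrite -(mulmxA _ (diag_mx d)) mulmx_diag.
by congr (_ *m diag_mx _ *m _); apply/rowP => i; rewrite !mxE exprS.
Qed.

Lemma cvg_sum_seq (R : realType) (I : Type) (r : seq I) (F : I -> nat -> R)
    (l : I -> R) :
  (forall i, F i @ \oo --> l i)%classic ->
  ((fun m => \sum_(i <- r) F i m) @ \oo --> \sum_(i <- r) l i)%classic.
Proof.
move=> Fl; elim: r => [|i r IH].
  by rewrite big_nil; under eq_fun do rewrite big_nil; exact: cvg_cst.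
rewrite big_cons; under eq_fun do rewrite big_cons.
exact: (cvgD (Fl i) IH).
Qed.

(** In the eigenbasis every entry of the partial sums is a fixed linear combination of partial sums
    of scalar exponential series, so the entrywise limits exist and are the expected ones. *)
Lemma expmx_spectral (R : realType) n (P : 'M[R]_n) (d : 'rV[R]_n) :
  P *m P^T = 1%:M ->
  expmx (P^T *m diag_mx d *m P) = P^T *m diag_mx (\row_i expR (d 0 i)) *m P.
Proof.
have entry (e : 'rV[R]_n) i j : (P^T *m diag_mx e *m P) i j
    = \sum_l P l i * P l j * e 0 l.
  rewrite mxE; apply: eq_bigr => l _.
  by rewrite mul_mx_diag !mxE mulrAC.
move=> PP; apply/matrixP => i j; rewrite mxE entry.
apply: cvg_lim => //.
have -> : (fun m => \sum_(k < m) ((P^T *m diag_mx d *m P) ^+ k) i j / (k`!)%:R)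
    = (fun m => \sum_l P l i * P l j * series (exp_coeff (d 0 l)) m).
  apply/funext => m.
  under eq_bigr do rewrite expr_spectral // entry mulr_suml.
  rewrite exchange_big /=; apply: eq_bigr => l _.
  rewrite /series /= big_mkord mulr_sumr; apply: eq_bigr => k _.
  by rewrite mxE mulrA.
apply: cvg_sum_seq => l; rewrite mxE; apply: cvgMl_tmp.
exact: is_cvg_series_exp_coeff.
Qed.

Lemma gibbs_spectral (R : realType) N K (C : 'BM[R]_(N, K)) (beta : R)
    (Lambda : 'I_N -> 'M[R]_K) :
  C^T = C -> (forall i, (Lambda i)^T = Lambda i) ->
  exists (P : 'M[R]_(\sum_(i < N) K)) (h : 'rV[R]_(\sum_(i < N) K)),
  [/\ P *m P^T = 1%:M, C - \mxdiag_i Lambda i = P^T *m diag_mx h *m P &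
    gibbs C beta Lambda = P^T *m
      diag_mx (\row_i (expR (- beta * h 0 i) / \sum_j expR (- beta * h 0 j)))
      *m P].
Proof.
move=> Cs Ls.
have Hs : (C - \mxdiag_i Lambda i)^T = C - \mxdiag_i Lambda i.
  rewrite linearB /= Cs tr_mxdiag; congr (_ - _).
  exact: eq_mxdiag.
have [P [h [PP HE]]] := sym_spectral Hs.
exists P, h; split => //; rewrite /gibbs HE.
have -> : - beta *: (P^T *m diag_mx h *m P)
    = P^T *m diag_mx (- beta *: h) *m P.
  by rewrite scalemxAl scalemxAr -linearZ.
rewrite expmx_spectral // trace_spectral // scalemxAl scalemxAr -linearZ /=.
congr (_ *m diag_mx _ *m _); apply/rowP => i; rewrite !mxE mulrC.
by congr (_ / _); apply: eq_bigr => j _; rewrite !mxE.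
Qed.

Lemma sum_const_gt0 N K : (0 < N)%N -> (0 < K)%N -> (0 < \sum_(i < N) K)%N.
Proof. by move=> N0 K0; rewrite big_const_ord iter_addn_0 muln_gt0 K0. Qed.

Lemma gibbs_psd (R : realType) N K (C : 'BM[R]_(N, K)) (beta : R)
    (Lambda : 'I_N -> 'M[R]_K) :
  C^T = C -> (forall i, (Lambda i)^T = Lambda i) ->
  psdmx (gibbs C beta Lambda).
Proof.
move=> Cs Ls; have [P [h [_ _ ->]]] := gibbs_spectral beta Cs Ls.
apply: spectral_psd => i; rewrite mxE divr_ge0 ?expR_ge0 //.
by apply: sumr_ge0 => j _; rewrite expR_ge0.
Qed.

Lemma sum_expR_gt0 (R : realType) n (x : 'I_n -> R) :
  (0 < n)%N -> 0 < \sum_i expR (x i).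
Proof.
move=> n0; rewrite (bigD1 (Ordinal n0)) //= ltr_wpDr ?expR_gt0 //.
by apply: sumr_ge0 => i _; rewrite expR_ge0.
Qed.

Lemma gibbs_trace (R : realType) N K (C : 'BM[R]_(N, K)) (beta : R)
    (Lambda : 'I_N -> 'M[R]_K) :
  (0 < N)%N -> (0 < K)%N ->
  C^T = C -> (forall i, (Lambda i)^T = Lambda i) ->
  \tr (gibbs C beta Lambda) = 1.
Proof.
move=> N0 K0 Cs Ls; have [P [h [PP _ ->]]] := gibbs_spectral beta Cs Ls.
rewrite trace_spectral //; under eq_bigr do rewrite mxE.
rewrite -mulr_suml mulfV // gt_eqF //.
exact/sum_expR_gt0/sum_const_gt0.
Qed.

(** The products [g i * expR (a i)] all equal [g i0], which is at most 1. Applying [1 + x <= expR x]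
    to [x = a i - ln n] and averaging with the weights [g] gives [1 + \sum_i g i * a i - ln n <= 1].
    This plays the part of the entropy bound. *)
Lemma gibbs_weights (R : realType) n (beta : R) (h : 'I_n -> R) i0 :
  0 < beta -> (forall i, h i0 <= h i) ->
  \sum_i expR (- beta * h i) / (\sum_j expR (- beta * h j)) * (h i - h i0)
    <= beta^-1 * ln n%:R.
Proof.
move=> b0 hmin; have n0 : (0 < n)%N := leq_ltn_trans (leq0n i0) (ltn_ord i0).
have nR : 0 < n%:R :> R by rewrite ltr0n.
set Z := \sum_j expR _; have Z0 : 0 < Z by exact: sum_expR_gt0.
pose g i := expR (- beta * h i) / Z; pose a i := beta * (h i - h i0).
have g0 i : 0 <= g i by rewrite divr_ge0 ?expR_ge0 // ltW.
have g1 : \sum_i g i = 1 by rewrite -mulr_suml mulfV // gt_eqF.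
have ga i : g i * expR (a i) <= 1.
  rewrite mulrAC -expRD /a.
  have -> : - beta * h i + beta * (h i - h i0) = - beta * h i0 by ring.
  by rewrite -g1 (bigD1 i0) //= lerDl sumr_ge0.
have gE i : g i * (1 + (a i - ln n%:R)) <= n%:R^-1.
  apply: le_trans (ler_wpM2l (g0 i) (expR_ge1Dx _)) _.
  by rewrite expRB lnK ?posrE // mulrA ler_piMl ?invr_ge0 ?(ltW nR) ?ga.
have : \sum_i g i * (1 + (a i - ln n%:R)) <= 1.
  apply: le_trans (ler_sum _ (fun i _ => gE i)) _.
  by rewrite sumr_const card_ord -[n%:R^-1 *+ n]mulr_natl mulfV // gt_eqF.
under eq_bigr do rewrite addrCA mulrDr.
rewrite big_split /= -mulr_suml g1 mul1r addrCA -lerBrDl subrr subr_le0 => le.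
rewrite -(ler_pM2l b0) mulVKf ?gt_eqF // mulr_sumr.
by apply: le_trans le; apply: ler_sum => i _; rewrite /a mulrCA.
Qed.

(** Equal diagonal blocks have equal traces against the block diagonal matrix of the [Lambda i], so
    [C] may be replaced by the exponentiated Hamiltonian. The diagonal of [Y] in its eigenbasis is a
    probability vector, so [Y] costs at least the lowest eigenvalue. The Gibbs weights exceed that
    by at most [ln n / beta]. *)
Lemma gibbs_variational (R : realType) N K (C Y : 'BM[R]_(N, K)) (beta : R)
    (Lambda : 'I_N -> 'M[R]_K) :
  (0 < N)%N -> (0 < K)%N -> 0 < beta ->
  C^T = C -> (forall i, (Lambda i)^T = Lambda i) ->
  let X := gibbs C beta Lambda in
  psdmx Y -> (forall i, Y^(i, i) = X^(i, i)) ->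
  \tr (C *m X) - \tr (C *m Y) <= beta^-1 * ln (N * K)%:R.
Proof.
move=> N0 K0 b0 Cs Ls X Yp YX.
have trY : \tr Y = 1.
  rewrite -(gibbs_trace beta N0 K0 Cs Ls) !trace_block.
  by apply: eq_bigr => i _; rewrite YX.
have [P [h [PP HE XE]]] := gibbs_spectral beta Cs Ls.
have -> : \tr (C *m X) - \tr (C *m Y) =
    \tr ((C - \mxdiag_i Lambda i) *m X) - \tr ((C - \mxdiag_i Lambda i) *m Y).
  suff E : \tr (\mxdiag_i Lambda i *m X) = \tr (\mxdiag_i Lambda i *m Y).
    by rewrite !mulmxBl ![\tr (_ - _)]raddfB /= E; ring.
  rewrite -[X]submxblockK -[Y]submxblockK !mul_mxdiag_mxblock !mxtrace_mxblock.
  by apply: eq_bigr => i _; rewrite YX.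
have trP (Q : 'M[R]_(\sum_(i < N) K)) :
    \tr (P^T *m diag_mx h *m P *m Q) = \sum_i h 0 i * (P *m Q *m P^T) i i.
  rewrite -!mulmxA mxtrace_mulC -mulmxA mul_diag_mx mulmxA.
  by apply: eq_bigr => i _; rewrite mxE.
rewrite HE !trP.
pose p i := (P *m Y *m P^T) i i.
have p0 i : 0 <= p i.
  have := Yp.2 ((row i P)^T); rewrite trmxK.
  suff -> : (row i P *m Y *m (row i P)^T) 0 0 = p i by [].
  by rewrite -row_mul /p !mxE; apply: eq_bigr => j _; rewrite !mxE.
have p1 : \sum_i p i = 1.
  by rewrite -[LHS]/(\tr _) mxtrace_mulC mulmxA (mulmx1C PP) mul1mx.
have [i0 _ hmin] := arg_minP (fun i => h 0 i)
  (erefl true : xpredT (Ordinal (sum_const_gt0 N0 K0))).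
have -> : (N * K)%N = (\sum_(i < N) K)%N.
  by rewrite big_const_ord iter_addn_0 mulnC.
apply: le_trans (gibbs_weights b0 (fun i => hmin i isT)).
pose g i := expR (- beta * h 0 i) / \sum_j expR (- beta * h 0 j).
have gE i : (P *m X *m P^T) i i = g i.
  rewrite [X]XE !mulmxA PP mul1mx -mulmxA PP mulmx1.
  by rewrite !mxE eqxx mulr1n.
have g1 : \sum_i g i = 1.
  by rewrite -mulr_suml mulfV // gt_eqF //; exact/sum_expR_gt0/sum_const_gt0.
under eq_bigr do rewrite gE mulrC.
have gh : \sum_i g i * (h 0 i - h 0 i0) = \sum_i g i * h 0 i - h 0 i0.
  under eq_bigr do rewrite mulrBr.
  by rewrite sumrB -mulr_suml g1 mul1r.
rewrite [leRHS]gh lerD2l lerN2 -[h 0 i0]mulr1 -p1 mulr_sumr.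
by apply: ler_sum => i _; rewrite ler_wpM2r // hmin.
Qed.

(** * Positivity criteria and comparison of matrix norms *)

Definition frobenius_norm (R : rcfType) m n (A : 'M[R]_(m, n)) : R :=
  Num.sqrt (\sum_i \sum_j A i j ^+ 2).

Lemma frobenius_norm_ge0 (R : rcfType) m n (A : 'M[R]_(m, n)) :
  0 <= frobenius_norm A.
Proof. exact: sqrtr_ge0. Qed.

Lemma frobenius_norm_spectral (R : rcfType) n (P : 'M[R]_n) (d : 'rV[R]_n) :
  P *m P^T = 1%:M ->
  frobenius_norm (P^T *m diag_mx d *m P) = Num.sqrt (\sum_i d 0 i ^+ 2).
Proof.
move=> PP; congr (Num.sqrt _).
have -> : \sum_i d 0 i ^+ 2 = \sum_i (\row_j d 0 j ^+ 2) 0 i.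
  by apply: eq_bigr => i _; rewrite mxE.
rewrite -(trace_spectral _ PP) -expr_spectral //.
set D := P^T *m _ *m _; have Ds : D^T = D.
  by rewrite !trmx_mul trmxK tr_diag_mx mulmxA.
have -> : D ^+ 2 = D *m D^T by rewrite Ds.
apply: eq_bigr => i _; rewrite [RHS]mxE; apply: eq_bigr => j _.
by rewrite [D^T _ _]mxE expr2.
Qed.

Lemma psd_sub_scalar (R : realType) n (P : 'M[R]_n) (d : 'rV[R]_n) (a b : R) :
  P *m P^T = 1%:M -> (forall i, 0 <= a + b * d 0 i) ->
  psdmx (a%:M + b *: (P^T *m diag_mx d *m P)).
Proof.
move=> PP ge.
have -> : a%:M + b *: (P^T *m diag_mx d *m P)
    = P^T *m diag_mx (\row_i (a + b * d 0 i)) *m P.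
  have -> : \row_i (a + b * d 0 i) = const_mx a + b *: d.
    by apply/rowP => i; rewrite !mxE.
  rewrite linearD /= diag_const_mx mulmxDr mulmxDl mul_mx_scalar -scalemxAl.
  by rewrite (mulmx1C PP) scalemx1 scalemxAl scalemxAr -linearZ.
by apply: spectral_psd => i; rewrite mxE.
Qed.

Lemma nuclear_norm_psd (R : realType) n (D : 'M[R]_n) (a : R) :
  D^T = D -> nuclear_norm D <= a -> psdmx (a%:M + D).
Proof.
move=> Ds; have [P [d [PP ->]]] := sym_spectral Ds.
rewrite nuclear_norm_spectral // => da.
rewrite -[P^T *m _ *m _]scale1r; apply: psd_sub_scalar => // i.
rewrite mul1r -lerBlDr sub0r; apply: le_trans da.
rewrite (bigD1 i) //= -[leLHS]addr0 lerD ?sumr_ge0 //.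
by rewrite -normrN ler_norm.
Qed.

Lemma frobenius_norm_psd (R : realType) n (D : 'M[R]_n) (a : R) :
  D^T = D -> frobenius_norm D <= a -> psdmx (a%:M - D).
Proof.
move=> Ds; have [P [d [PP ->]]] := sym_spectral Ds.
rewrite frobenius_norm_spectral // => da.
rewrite -scaleN1r; apply: psd_sub_scalar => // i.
rewrite mulN1r subr_ge0; apply: le_trans da.
apply: le_trans (ler_norm _) _; rewrite -sqrtr_sqr ler_wsqrtr //.
by rewrite (bigD1 i) //= lerDl sumr_ge0 // => j _; rewrite sqr_ge0.
Qed.

Lemma frobenius_le_nuclear (R : realType) n (D : 'M[R]_n) :
  D^T = D -> frobenius_norm D <= nuclear_norm D.
Proof.
move=> Ds; have [P [d [PP ->]]] := sym_spectral Ds.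
rewrite frobenius_norm_spectral // nuclear_norm_spectral //.
have s0 : 0 <= \sum_i `|d 0 i| by apply: sumr_ge0.
rewrite -[leRHS]ger0_norm // -sqrtr_sqr ler_wsqrtr // expr2 mulr_suml.
apply: ler_sum => i _; rewrite -real_normK ?num_real // expr2 ler_wpM2l //.
by rewrite (bigD1 i) //= lerDl sumr_ge0.
Qed.

Lemma trace_le_nuclear (R : realType) n (D : 'M[R]_n) :
  D^T = D -> \tr D <= nuclear_norm D.
Proof.
move=> Ds; have [P [d [PP ->]]] := sym_spectral Ds.
rewrite trace_spectral // nuclear_norm_spectral //.
by apply: ler_sum => i _; exact: ler_norm.
Qed.

Lemma psd_mxsub (R : realType) n K (X : 'M[R]_n) (f : 'I_K -> 'I_n) :
  psdmx X -> psdmx (mxsub f f X).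
Proof.
move=> /psd_factor[W ->].
have -> : mxsub f f (W^T *m W) = (colsub f W)^T *m colsub f W.
  by apply/matrixP => i j; rewrite !mxE; apply: eq_bigr => l _; rewrite !mxE.
exact: psd_gram.
Qed.

Lemma psd_scale (R : realType) n (a : R) (A : 'M[R]_n) :
  0 <= a -> psdmx A -> psdmx (a *: A).
Proof.
move=> a0 [As A0]; split=> [|v]; first by rewrite linearZ /= As.
by rewrite -scalemxAr -scalemxAl mxE mulr_ge0.
Qed.

(** * The two roundings *)

(** The lower bound on [z] ensures positivity and the upper bound controls the cost, since
    [1 - s i = z / (1 + z) <= z]. The slack between the Frobenius and nuclear norms leaves room for
    an approximate computation of [z]. *)
Lemma round_to_feasible (R : realType) N K (C X : 'BM[R]_(N, K))
    (s : 'I_N -> R) :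
  let n : R := (N * K)%:R in
  let D i := X^(i, i) - (n^-1)%:M in
  let X' := round_blocks s (fun=> (n^-1)%:M) X in
  (0 < N)%N -> (0 < K)%N -> C^T = C -> psdmx X ->
  (forall i, exists z, [/\ s i = (1 + z)^-1,
     n * frobenius_norm (D i) <= 2%:R * z & z <= n * nuclear_norm (D i)]) ->
  feasible X' /\
  `|\tr (C *m X') - \tr (C *m X)|
    <= (2 * K + 1)%:R * (\sum_i nuclear_norm (D i)) * block_norm C.
Proof.
move=> n D X' N0 K0 Cs Xp sz.
have n0 : 0 < n by rewrite ltr0n muln_gt0 N0.
have Ds i : (D i)^T = D i.
  by rewrite linearB /= tr_scalar_mx tr_submxblock Xp.1.
have F0 i (z : R) : n * frobenius_norm (D i) <= 2%:R * z -> 0 <= z.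
  move=> zF; rewrite -(pmulr_rge0 _ (ltr0Sn R 1)) (le_trans _ zF) //.
  by rewrite mulr_ge0 ?frobenius_norm_ge0 ?ltW.
have X'p : psdmx X'.
  apply: round_blocks_psd => // i; have [z [-> zF _]] := sz i.
  have z0 := F0 _ _ zF.
  (* After factoring out [s i ^+ 2], positivity requires only [n] times the Frobenius norm of [D i]
     to be at most [(1 + z)^2 - 1 = 2 z + z^2]. *)
  have -> : (n^-1)%:M - (1 + z)^-1 ^+ 2 *: X^(i, i) =
      (1 + z)^-1 ^+ 2 *: ((((1 + z) ^+ 2 - 1) / n)%:M - D i).
    rewrite /D opprB addrA -raddfD /= mulrBl mul1r subrK scalerBr.
    rewrite scale_scalar_mx mulrA -exprMn mulVf ?expr1n ?mul1r // gt_eqF //.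
    by rewrite ltr_wpDr.
  apply: psd_scale; first by rewrite sqr_ge0.
  apply: frobenius_norm_psd => //.
  rewrite ler_pdivlMr // mulrC (le_trans zF) //.
  by have := sqr_ge0 z; rewrite !expr2; lra.
split.
  split => //; first by case: X'p.
    by move=> i; rewrite round_blocks_diag.
  rewrite trace_block; under eq_bigr do rewrite round_blocks_diag mxtrace_scalar.
  by rewrite sumr_const card_ord -mulrnA -mulr_natl mulnC mulfV // gt_eqF.
apply: (@round_blocks_cost _ _ _ n) => //.
- move=> i; have [z [-> zF _]] := sz i.
  have z0 := F0 _ _ zF.
  by rewrite invr_ge0 addr_ge0 //= invf_le1 ?lerDl // ltr_wpDr.
- by move=> i; exact: nuclear_norm_ge0.
- move=> i; have [z [-> zF zN]] := sz i; apply: le_trans zN.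
  have z0 := F0 _ _ zF.
  have z1 : 0 < 1 + z by rewrite ltr_wpDr.
  have -> : 1 - (1 + z)^-1 = z / (1 + z) by field; rewrite gt_eqF.
  by rewrite ler_pdivrMr // ler_peMr // lerDl.
- move=> i; have := trace_le_nuclear (Ds i).
  by rewrite raddfB /= mxtrace_scalar mulr_natl lerBlDl.
- move=> i; have -> : (n^-1)%:M - X^(i, i) = - D i by rewrite opprB.
  by rewrite mulmxN raddfN normrN; exact: trace_mul_sym.
Qed.

Lemma round_to_blocks (R : realType) N K (C X Y : 'BM[R]_(N, K)) :
  let n : R := (N * K)%:R in
  let D i := X^(i, i) - (n^-1)%:M in
  (0 < N)%N -> (0 < K)%N -> C^T = C -> psdmx X -> feasible Y ->
  exists Y' : 'BM[R]_(N, K), [/\ psdmx Y', forall i, Y'^(i, i) = X^(i, i) &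
  `|\tr (C *m Y') - \tr (C *m Y)|
    <= (2 * K + 1)%:R * (\sum_i nuclear_norm (D i)) * block_norm C].
Proof.
move=> n D N0 K0 Cs Xp [_ Yi _ Yp].
have n0 : 0 < n by rewrite ltr0n muln_gt0 N0.
have Ds i : (D i)^T = D i.
  by rewrite linearB /= tr_scalar_mx tr_submxblock Xp.1.
pose s i : R := Num.max 0 (1 - n * nuclear_norm (D i)).
have s0 i : 0 <= s i by rewrite le_max lexx.
have s1 i : s i <= 1.
  by rewrite ge_max ler01 lerBlDr lerDl mulr_ge0 ?nuclear_norm_ge0 ?ltW.
exists (round_blocks s (fun i => X^(i, i)) Y); split.
- apply: round_blocks_psd => // i; rewrite Yi.
  (* If [n d_i >= 1], the weight is 0 and the block of [X] is psd by itself. Otherwise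
     [n d_i = 1 - s i <= 1 - s i ^+ 2], so the multiple [(1 - s i ^+ 2) / n] of the identity
     compensates the negative eigenvalues of [D i]. *)
  have [sE|sE] := leP (1 - n * nuclear_norm (D i)) 0.
    rewrite /s (max_idPl sE) expr0n scale0r subr0; exact: psd_mxsub.
  have -> : X^(i, i) - s i ^+ 2 *: (n^-1)%:M =
     ((1 - s i ^+ 2) / n)%:M + D i.
    rewrite /D scale_scalar_mx mulrBl mul1r.
    rewrite (raddfB (@scalar_mx R K)) /=.
    by rewrite [RHS]addrC addrA subrK.
  apply: nuclear_norm_psd => //; rewrite ler_pdivlMr // mulrC lerBrDr -lerBrDl.
  have <- : s i = 1 - n * nuclear_norm (D i) by rewrite /s (max_idPr (ltW sE)).
  by rewrite expr2 ler_piMl.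
- by move=> i; rewrite round_blocks_diag.
apply: (@round_blocks_cost _ _ _ n) => //.
- by move=> i; rewrite s0 s1.
- by move=> i; exact: nuclear_norm_ge0.
- by move=> i; rewrite lerBlDl -lerBlDr le_max lexx orbT.
- by move=> i; rewrite Yi mxtrace_scalar mulr_natl lerDl nuclear_norm_ge0.
- by move=> i; rewrite Yi; exact: (trace_mul_sym _ (Ds i)).
Qed.

Lemma gibbs_le_feasible (R : realType) N K (C Y : 'BM[R]_(N, K)) (beta : R)
    (Lambda : 'I_N -> 'M[R]_K) :
  (0 < N)%N -> (0 < K)%N -> C^T = C -> 0 < beta ->
  (forall i, (Lambda i)^T = Lambda i) ->
  let X := gibbs C beta Lambda in
  feasible Y ->
  \tr (C *m X) <= \tr (C *m Y) + beta^-1 * ln (N * K)%:R +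
    (2 * K + 1)%:R *
    (\sum_i nuclear_norm (X^(i, i) - ((N * K)%:R^-1)%:M)) * block_norm C.
Proof.
move=> N0 K0 Cs b0 Ls X Yf.
have Xp : psdmx X by exact: gibbs_psd.
have [Y' [Y'p Y'X]] := round_to_blocks N0 K0 Cs Xp Yf.
have := gibbs_variational N0 K0 b0 Cs Ls Y'p Y'X; rewrite -/X => h1 h2.
have := le_trans (ler_norm _) h2; lra.
Qed.

(** * Rounding on the real RAM *)

Section Programs.
Variable R : realType.
Implicit Types (env : nat -> nat) (st : memory R * nat) (c : cmd).

Definition bind env x k : nat -> nat := fun y => if y == x then k else env y.

Fixpoint assigns (a : nat) c : bool :=
  match c with
  | Skip => false
  | Seq c1 c2 => assigns a c1 || assigns a c2
  | Assign b _ _ _ => a == b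
  | For _ _ c1 => assigns a c1
  | IfIntLe _ _ c1 c2 => assigns a c1 || assigns a c2
  | IfRealLe _ _ c1 c2 => assigns a c1 || assigns a c2
  end.

(** The loop-invariant rule. The invariant sees only the memory, which lets the step counter drop
    out of all correctness proofs. *)
Lemma exec_For_ind (I : nat -> memory R -> Prop) x e c env st :
  I 0%N st.1 ->
  (forall k st', (k < ieval env e)%N -> I k st'.1 ->
     I k.+1 (exec c (bind env x k) st').1) ->
  I (ieval env e) (exec (For x e c) env st).1.
Proof.
move=> I0 IS /=; set n := ieval env e in IS *.
set s0 := (st.1, st.2.+1); have {}I0 : I 0%N s0.1 by [].
elim: n IS => [|n IH] IS //.
rewrite -[in iota _ _]addn1 iotaD foldl_cat /=.
set s1 := foldl _ _ _; rewrite add0n; apply: (IS _ (s1.1, s1.2.+1)) => //.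
by apply: IH => k st' kn; apply: IS; exact: ltnW.
Qed.

Lemma exec_frame a c env st :
  ~~ assigns a c -> (exec c env st).1 a = st.1 a.
Proof.
elim: c env st => [|c1 IH1 c2 IH2|b i j e|x e c IH|e1 e2 c1 IH1 c2 IH2
  |e1 e2 c1 IH1 c2 IH2] env st //=.
- by rewrite negb_or => /andP[h1 h2]; rewrite IH2 ?IH1.
- move=> /negPf ab; apply/funext => p; apply/funext => q.
  by rewrite /write !xpair_eqE ab.
- move=> ac.
  apply: (@exec_For_ind (fun _ m => m a = st.1 a) x e) => // k st' _ <-.
  exact: IH.
- by rewrite negb_or => /andP[h1 h2]; case: ifP => _; rewrite ?IH1 ?IH2.
- by rewrite negb_or => /andP[h1 h2]; case: ifP => _; rewrite ?IH1 ?IH2.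
Qed.

(** The base [M + 2] is at least 2, so a literal [k] is below its [k]-th power and one extra factor
    absorbs the 2 arising from a sum. *)
Lemma ieval_bound (e : iexp) : exists d, forall env M,
  (forall x, (env x <= M)%N) -> (ieval env e <= (M + 2) ^ d)%N.
Proof.
have pos M d : (0 < (M + 2) ^ d)%N by rewrite expn_gt0 addnS.
have big M d : (d < (M + 2) ^ d)%N.
  by apply: ltn_expl; rewrite addn2.
elim: e => [x|k|e1 [d1 h1] e2 [d2 h2]|e1 [d1 h1] e2 [d2 h2]
  |e1 [d1 h1] e2 [d2 h2]].
- by exists 1%N => env M h; rewrite expn1 (leq_trans (h x)) // leq_addr.
- by exists k => env M _; rewrite ltnW.
- exists (d1 + d2).+1 => env M h /=.
  apply: leq_trans (leq_add (h1 _ _ h) (h2 _ _ h)) _.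
  rewrite expnS expnD addn2 -(addn2 M).
  have := pos M d1; have := pos M d2; nia.
- exists d1 => env M h /=.
  exact: leq_trans (leq_subr _ _) (h1 _ _ h).
- exists (d1 + d2)%N => env M h /=.
  by rewrite expnD leq_mul ?h1 ?h2.
Qed.

(** Loop lengths are integer expressions, hence polynomial in the bound [M] on the environment. A
    loop enlarges that bound only polynomially for its body, and the nesting depth is fixed by the
    program. *)
Lemma exec_time_bound c : exists d, forall env M st,
  (forall x, (env x <= M)%N) ->
  ((exec c env st).2 <= st.2 + (M + 2) ^ d)%N.
Proof.
have pos M d : (0 < (M + 2) ^ d)%N by rewrite expn_gt0 addnS.
have ifb c1 c2 (b : bool) d1 d2 env M (m : memory R) t :
    ((exec c1 env (m, t)).2 <= t + (M + 2) ^ d1)%N ->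
    ((exec c2 env (m, t)).2 <= t + (M + 2) ^ d2)%N ->
    ((exec (if b then c1 else c2) env (m, t)).2 <= t + (M + 2) ^ (d1 + d2))%N.
  have := pos M d1; have := pos M d2; rewrite expnD.
  by case: b; nia.
elim: c => [|c1 [d1 h1] c2 [d2 h2]|b i j e|x e c [d h]|e1 e2 c1 [d1 h1] c2 [d2 h2]
  |e1 e2 c1 [d1 h1] c2 [d2 h2]].
- by exists 0%N => env M st _ /=; rewrite leq_addr.
- exists (d1 + d2).+1 => env M st Mb /=.
  have := h1 env M st Mb; have := h2 env M (exec c1 env st) Mb.
  have := pos M d1; have := pos M d2; rewrite expnS expnD addn2 -(addn2 M).
  nia.
- by exists 0%N => env M st _ /=; rewrite expn0 addn1.
- have [de he] := ieval_bound e.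
  (* In the body the variables are bounded by [M + (M + 2)^de], which plus 2 is at most
     [(M + 2)^(de + 2)]. This gives the cost [B] of one iteration. The two further factors absorb
     the loop overhead. *)
  exists (de + de.+2 * d).+2 => env M st Mb /=.
  have := he env M Mb; set n := ieval env e => nM.
  set B := ((M + 2) ^ (de.+2 * d))%N.
  have step k (st' : memory R * nat) :
      (k < n)%N -> ((exec c (bind env x k) st').2 <= st'.2 + B)%N.
    move=> kn; rewrite /B expnM.
    apply: leq_trans (h _ (M + (M + 2) ^ de)%N _ _) _.
      move=> y; rewrite /bind; case: ifP => _.
        by rewrite (leq_trans (ltnW kn)) // (leq_trans nM) // leq_addl.
      by rewrite (leq_trans (Mb y)) // leq_addr.
    rewrite leq_add2l; case: (d) => [|d']; first by rewrite !expn0.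
    rewrite leq_exp2r // !expnS addnAC addn2 -(addn2 M); have := pos M de; nia.
  have loop m (s0 : memory R * nat) : (m <= n)%N -> ((foldl
      (fun s k => exec c (bind env x k) (s.1, s.2.+1)) s0 (iota 0 m)).2
      <= s0.2 + m * B.+1)%N.
    elim: m => [|m IH] mn; first by rewrite addn0.
    rewrite -[in iota _ _]addn1 iotaD foldl_cat /= add0n.
    apply: leq_trans (step _ _ mn) _ => /=.
    by have := IH (ltnW mn); nia.
  apply: leq_trans (loop n _ (leqnn n)) _ => /=.
  rewrite !expnS expnD -/B; have := pos M de; have := pos M (de.+2 * d)%N.
  rewrite -/B !addn2 -!(addn2 M); nia.
- exists (d1 + d2).+1 => env M st Mb /=.
  apply: leq_trans (ifb _ _ _ _ _ _ _ _ _ (h1 _ _ _ Mb) (h2 _ _ _ Mb)) _.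
  rewrite /= [X in (_ <= _ + X)%N]expnS; have := pos M (d1 + d2)%N.
  rewrite addn2; nia.
- exists (d1 + d2).+1 => env M st Mb /=.
  apply: leq_trans (ifb _ _ _ _ _ _ _ _ _ (h1 _ _ _ Mb) (h2 _ _ _ Mb)) _.
  rewrite /= [X in (_ <= _ + X)%N]expnS; have := pos M (d1 + d2)%N.
  rewrite addn2; nia.
Qed.
End Programs.

Lemma poly_time_cmd (R : realType) (P : cmd) : poly_time R P.
Proof.
(* With [M = N K >= 1] one has [M + 2 <= 3 M], whence the constant [3 ^ d]. *)
have [d h] := exec_time_bound R P; exists (3 ^ d)%N, d => N K X N0 K0.
apply: leq_trans (h _ (N * K)%N _ _) _ => /=.
  by case=> [|[|[|x]]] //=; [rewrite leq_pmulr | rewrite leq_pmull].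
rewrite add0n -expnMn; case: (d) => [|d'] //; rewrite leq_exp2r //.
have : (0 < N * K)%N by rewrite muln_gt0 N0.
lia.
Qed.

(* Every subtraction of integers is truncated, so that [kron] is the Kronecker
   delta. Variables 2, 3 are block indices and 4, 5 indices inside a block; for
   the current block i, registers 2 and 3 collect the sum of the squares and the
   sum of the absolute values of the entries of n X^(i,i) - I (register 5),
   register 4 approximates the Frobenius norm, and array 6 receives s_i. *)
Definition kron (e1 e2 : iexp) : iexp :=
  ISub (ILit 1) (IAdd (ISub e1 e2) (ISub e2 e1)).
Definition addr (e1 e2 : iexp) : iexp := IAdd (IMul e1 (IVar 1)) e2.
Definition size_exp : rexp := RInt (IMul (IVar 0) (IVar 1)).
Definition reg (k : nat) : rexp := RCell k (ILit 0) (ILit 0).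
Definition set_reg (k : nat) (e : rexp) : cmd := Assign k (ILit 0) (ILit 0) e.

Definition gap_cmd : cmd :=
  set_reg 5 (RSub
    (RMul size_exp (RCell 0 (addr (IVar 2) (IVar 4)) (addr (IVar 2) (IVar 5))))
    (RInt (kron (IVar 4) (IVar 5)))).

Definition add_cmd : cmd :=
  Seq (set_reg 2 (RAdd (reg 2) (RMul (reg 5) (reg 5))))
    (IfRealLe (RInt (ILit 0)) (reg 5)
      (set_reg 3 (RAdd (reg 3) (reg 5)))
      (set_reg 3 (RSub (reg 3) (reg 5)))).

Definition entry_cmd : cmd := Seq gap_cmd add_cmd.

Definition search_cmd : cmd :=
  IfRealLe (reg 2) (RMul (reg 4) (reg 4)) Skip
    (set_reg 4 (RAdd (reg 4) (RDiv (reg 3) (RInt (IVar 1))))).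

Definition reset_cmd : cmd :=
  Seq (set_reg 2 (RInt (ILit 0)))
    (Seq (set_reg 3 (RInt (ILit 0))) (set_reg 4 (RInt (ILit 0)))).

Definition sums_cmd : cmd := For 4 (IVar 1) (For 5 (IVar 1) entry_cmd).

Definition weight_cmd : cmd :=
  Assign 6 (IVar 2) (ILit 0) (RDiv (RInt (ILit 1))
    (RAdd (RInt (ILit 1)) (RDiv (reg 4) (RInt (ILit 2))))).

Definition block_cmd : cmd :=
  Seq reset_cmd (Seq sums_cmd (Seq (For 4 (IVar 1) search_cmd) weight_cmd)).

(** Kronecker deltas select between the diagonal and the off-diagonal formula, so each entry is
    written by a single assignment without a test. *)
Definition output_cmd : cmd :=
  Assign 1 (addr (IVar 2) (IVar 4)) (addr (IVar 3) (IVar 5))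
    (RAdd
      (RMul (RInt (kron (IVar 2) (IVar 3)))
        (RDiv (RInt (kron (IVar 4) (IVar 5))) size_exp))
      (RMul (RInt (ISub (ILit 1) (kron (IVar 2) (IVar 3))))
        (RMul (RMul (RCell 6 (IVar 2) (ILit 0)) (RCell 6 (IVar 3) (ILit 0)))
          (RCell 0 (addr (IVar 2) (IVar 4)) (addr (IVar 3) (IVar 5)))))).

Lemma kronE (R : realType) env e1 e2 :
  (ieval env (kron e1 e2))%:R = (ieval env e1 == ieval env e2)%:R :> R.
Proof.
congr (_%:R) => /=; case: eqVneq => [->|ne]; first by rewrite !subnn.
by lia.
Qed.

(* The l^1-norm [S] of a K x K matrix is between its Frobenius norm [F] and
   [K F], so steps of size [S / K <= F] reach [F] after at most [K] steps without
   overshooting [2 F]. *)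
Lemma root_search (R : realType) (F S : R) K :
  (0 < K)%N -> 0 <= F -> F <= S -> S <= K%:R * F ->
  F <= iter K (fun w => if F ^+ 2 <= w * w then w else w + S / K%:R) 0
    <= 2%:R * F.
Proof.
move=> K0 F0 FS SF; have KR : 0 < K%:R :> R by rewrite ltr0n.
set f := fun w => _.
have S0 : 0 <= S := le_trans F0 FS.
have inv k : [/\ 0 <= iter k f 0, iter k f 0 <= 2%:R * F &
    F <= iter k f 0 \/ iter k f 0 = k%:R * (S / K%:R)].
  elim: k => [|k [w0 w2 h]] /=.
    by split=> //; rewrite ?mulr_ge0 //; right; rewrite mul0r.
  set v := iter k f 0 in w0 w2 h *; rewrite /f.
  case: ifP => [|/negbT].
    rewrite -expr2 => Fv; split => //; left.
    by rewrite -(@ler_pXn2r _ 2) // nnegrE.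
  rewrite -ltNge -expr2 ltr_pXn2r ?nnegrE // => vF; split.
  - by rewrite addr_ge0 // divr_ge0 // ltW.
  - have -> : 2%:R * F = F + F by ring.
    by rewrite lerD ?(ltW vF) // ler_pdivrMr // mulrC.
  - right; case: h => [/le_lt_trans/(_ vF)|->]; first by rewrite ltxx.
    by rewrite -natr1; ring.
have [w0 w2 h] := inv K; rewrite w2 andbT.
by case: h => // ->; rewrite mulrC divfK // gt_eqF.
Qed.

Lemma sqr_sum_le_card (R : realFieldType) (T : finType) (x : T -> R) :
  (\sum_i x i) ^+ 2 <= #|T|%:R * \sum_i x i ^+ 2.
Proof.
have E2 : \sum_(i in T) \sum_j x j ^+ 2 = #|T|%:R * \sum_i x i ^+ 2.
  by rewrite sumr_const mulr_natl.
have E1 : \sum_(i in T) \sum_(j in T) x i ^+ 2 = #|T|%:R * \sum_i x i ^+ 2.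
  by rewrite exchange_big.
have -> : #|T|%:R * \sum_i x i ^+ 2 =
    \sum_i \sum_j (x i ^+ 2 + x j ^+ 2) / 2%:R.
  under [RHS]eq_bigr do rewrite -mulr_suml big_split /=.
  rewrite -mulr_suml big_split /= E1 E2; move: (_%:R * _) => a; lra.
rewrite expr2 mulr_suml; apply: ler_sum => i _; rewrite mulr_sumr.
apply: ler_sum => j _; have := sqr_ge0 (x i - x j); rewrite !expr2; lra.
Qed.

(** For the first bound, the square of a sum of nonnegative terms dominates the sum of their
    squares. The second is Cauchy-Schwarz over [K^2] entries, which gives the factor [K]. *)
Lemma sum_norm_le_frobenius (R : realType) K (D : 'M[R]_K) :
  frobenius_norm D <= \sum_i \sum_j `|D i j| /\
  \sum_i \sum_j `|D i j| <= K%:R * frobenius_norm D.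
Proof.
pose F := frobenius_norm D; rewrite -/F; set S := \sum_i _.
have F0 : 0 <= F := frobenius_norm_ge0 D.
have S0 : 0 <= S by apply: sumr_ge0 => i _; apply: sumr_ge0.
have Q0 : 0 <= \sum_i \sum_j D i j ^+ 2.
  by apply: sumr_ge0 => i _; apply: sumr_ge0 => j _; rewrite sqr_ge0.
have FE : F ^+ 2 = \sum_i \sum_j D i j ^+ 2 by rewrite sqr_sqrtr.
split.
  rewrite -(@ler_pXn2r _ 2) ?nnegrE // FE expr2 mulr_suml.
  apply: ler_sum => i _; rewrite mulr_suml; apply: ler_sum => j _.
  rewrite -real_normK ?num_real // expr2 ler_wpM2l //.
  apply: (@le_trans _ _ (\sum_j `|D i j|)); last first.
    rewrite /S [leRHS](bigD1 i) //= lerDl sumr_ge0 // => k _.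
    exact: sumr_ge0.
  by rewrite (bigD1 j) //= lerDl sumr_ge0.
rewrite -(@ler_pXn2r _ 2) ?nnegrE ?mulr_ge0 // exprMn FE /S !pair_big /=.
apply: le_trans (sqr_sum_le_card _) _.
rewrite card_prod card_ord natrM -expr2.
rewrite ler_wpM2l ?sqr_ge0 //; apply: ler_sum => p _.
by rewrite real_normK ?num_real.
Qed.

(** * Execution of the rounding program *)

Section RoundProgram.
Variable R : realType.
Implicit Types (env : nat -> nat) (st : memory R * nat).

Definition scaled_gap (N K : nat) (m : nat -> nat -> R) (i a b : nat) : R :=
  (N * K)%:R * m (i * K + a)%N (i * K + b)%N - (a == b)%:R.

Lemma entry_exec env st :
  let v := scaled_gap (env 0%N) (env 1%N) (st.1 0%N) (env 2) (env 4) (env 5) in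
  (exec entry_cmd env st).1 2 0%N 0%N = st.1 2 0%N 0%N + v ^+ 2 /\
  (exec entry_cmd env st).1 3 0%N 0%N = st.1 3 0%N 0%N + `|v|.
Proof.
move=> v.
pose st5 := exec gap_cmd env st.
have E5 : st5.1 5 0%N 0%N = v.
  by rewrite /v /scaled_gap -(kronE R env (IVar 4) (IVar 5)).
have E2 : st5.1 2 0%N 0%N = st.1 2 0%N 0%N by [].
have E3 : st5.1 3 0%N 0%N = st.1 3 0%N 0%N by [].
(* The memory after [gap_cmd] is generalized, so that [add_cmd] is evaluated on an opaque memory in
   which register 5 already holds the entry. *)
rewrite -E2 -E3 -E5; change (exec entry_cmd env st) with (exec add_cmd env st5).
move: st5 {E2 E3 E5} => s /=; rewrite /write /=.
by case: ifP => [v0|/negbT]; rewrite /= ?expr2 ?(ger0_norm v0) //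
  -ltNge => /ltW v0; rewrite ?(ler0_norm v0).
Qed.

Lemma row_exec env st :
  let v b := scaled_gap (env 0%N) (env 1%N) (st.1 0%N) (env 2) (env 4) b in
  let st' := exec (For 5 (IVar 1) entry_cmd) env st in
  st'.1 2 0%N 0%N = st.1 2 0%N 0%N + \sum_(b < env 1%N) v b ^+ 2 /\
  st'.1 3 0%N 0%N = st.1 3 0%N 0%N + \sum_(b < env 1%N) `|v b|.
Proof.
move=> v st'.
pose I k (m : memory R) := [/\ m 0%N = st.1 0%N,
  m 2 0%N 0%N = st.1 2 0%N 0%N + \sum_(b < k) v b ^+ 2 &
  m 3 0%N 0%N = st.1 3 0%N 0%N + \sum_(b < k) `|v b|].
suff [] : I (env 1%N) st'.1 by [].
apply: (@exec_For_ind _ I) => [|k s _ [m0 m2 m3]].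
  by split=> //; rewrite big_ord0 addr0.
have [e2 e3] := entry_exec (bind env 5 k) s.
split; first by rewrite exec_frame.
- rewrite e2 m2 big_ord_recr addrA; congr (_ + _).
  by rewrite /v /scaled_gap /= m0.
- rewrite e3 m3 big_ord_recr addrA; congr (_ + _).
  by rewrite /v /scaled_gap /= m0.
Qed.

Lemma sums_exec env st :
  let v a b := scaled_gap (env 0%N) (env 1%N) (st.1 0%N) (env 2) a b in
  let st' := exec sums_cmd env st in
  st'.1 2 0%N 0%N = st.1 2 0%N 0%N +
    \sum_(a < env 1%N) \sum_(b < env 1%N) v a b ^+ 2 /\
  st'.1 3 0%N 0%N = st.1 3 0%N 0%N +
    \sum_(a < env 1%N) \sum_(b < env 1%N) `|v a b|.
Proof.
move=> v st'.
pose I k (m : memory R) := [/\ m 0%N = st.1 0%N,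
  m 2 0%N 0%N = st.1 2 0%N 0%N + \sum_(a < k) \sum_(b < env 1%N) v a b ^+ 2 &
  m 3 0%N 0%N = st.1 3 0%N 0%N + \sum_(a < k) \sum_(b < env 1%N) `|v a b|].
suff [] : I (env 1%N) st'.1 by [].
apply: (@exec_For_ind _ I) => [|k s _ [m0 m2 m3]].
  by split=> //; rewrite big_ord0 addr0.
have [e2 e3] := row_exec (bind env 4 k) s.
split; first by rewrite exec_frame.
- rewrite e2 m2 big_ord_recr addrA; congr (_ + _).
  by apply: eq_bigr => b _; rewrite /v /scaled_gap /= m0.
- rewrite e3 m3 big_ord_recr addrA; congr (_ + _).
  by apply: eq_bigr => b _; rewrite /v /scaled_gap /= m0.
Qed.

Definition search_step (F2 S : R) (K : nat) (w : R) : R :=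
  if F2 <= w * w then w else w + S / K%:R.

Lemma search_exec env st :
  st.1 4 0%N 0%N = 0 ->
  (exec (For 4 (IVar 1) search_cmd) env st).1 4 0%N 0%N =
  iter (env 1%N)
    (search_step (st.1 2 0%N 0%N) (st.1 3 0%N 0%N) (env 1%N)) 0.
Proof.
move=> w0.
pose I k (m : memory R) := [/\ m 2 0%N 0%N = st.1 2 0%N 0%N,
  m 3 0%N 0%N = st.1 3 0%N 0%N & m 4 0%N 0%N =
  iter k (search_step (st.1 2 0%N 0%N) (st.1 3 0%N 0%N) (env 1%N)) 0].
suff [] : I (env 1%N) (exec (For 4 (IVar 1) search_cmd) env st).1 by [].
apply: (@exec_For_ind _ I) => // k s _ [m2 m3 m4].
split; [by rewrite exec_frame | by rewrite exec_frame |].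
by rewrite /= -m4 /search_step /= m2; case: ifP => _ //; rewrite /write /= m3.
Qed.

Definition block_weight (N K : nat) (m : nat -> nat -> R) (i : nat) : R :=
  let v := scaled_gap N K m i in
  (1 + iter K (search_step (\sum_(a < K) \sum_(b < K) v a b ^+ 2)
                 (\sum_(a < K) \sum_(b < K) `|v a b|) K) 0 / 2%:R)^-1.

Lemma block_exec env st :
  let st' := exec block_cmd env st in
  st'.1 6 (env 2) 0%N =
    block_weight (env 0%N) (env 1%N) (st.1 0%N) (env 2) /\
  forall p, p != env 2 -> st'.1 6 p 0%N = st.1 6 p 0%N.
Proof.
pose s1 := exec reset_cmd env st; pose s2 := exec sums_cmd env s1.
pose s3 := exec (For 4 (IVar 1) search_cmd) env s2.
have s34 : s3.1 4 0%N 0%N = iter (env 1%N)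
    (search_step (s2.1 2 0%N 0%N) (s2.1 3 0%N 0%N) (env 1%N)) 0.
  by apply: search_exec; rewrite exec_frame.
have [] := sums_exec env s1; rewrite -/s2.
have -> : s1.1 0%N = st.1 0%N by rewrite exec_frame.
have -> : s1.1 2 0%N 0%N = 0 by [].
have -> : s1.1 3 0%N 0%N = 0 by [].
rewrite !add0r => s22 s23; rewrite s22 s23 in s34.
change (exec block_cmd env st) with (exec weight_cmd env s3).
split=> [|p pi] /=.
  by rewrite /write /= eqxx s34 mul1r.
rewrite /write /= !xpair_eqE (negPf pi) /=.
by rewrite /s3 exec_frame // /s2 exec_frame.
Qed.

Lemma weights_exec env st i :
  (i < env 0%N)%N ->
  (exec (For 2 (IVar 0) block_cmd) env st).1 6 i 0%N =
    block_weight (env 0%N) (env 1%N) (st.1 0%N) i.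
Proof.
pose I k (m : memory R) := m 0%N = st.1 0%N /\ forall i, (i < k)%N ->
  m 6 i 0%N = block_weight (env 0%N) (env 1%N) (st.1 0%N) i.
suff [_ h] : I (env 0%N) (exec (For 2 (IVar 0) block_cmd) env st).1 by exact: h.
apply: (@exec_For_ind _ I) => // k s _ [m0 m6].
split; first by rewrite exec_frame.
have [e1 e2] := block_exec (bind env 2 k) s.
move=> p; rewrite ltnS leq_eqVlt => /predU1P[->|pk].
  by rewrite e1 m0.
by rewrite e2 ?m6 // ltn_eqF.
Qed.

(* Every value written to array 1 is the final one, so progress is monotone:
   entries of the output which agree with the target [V] keep doing so. *)
Definition extends (V : nat -> nat -> R) (m m' : memory R) :=
  [/\ m' 0%N = m 0%N, m' 6 = m 6 &
      forall p q, m 1%N p q = V p q -> m' 1%N p q = V p q].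

(** What iteration [k] achieves survives the later iterations, because they only extend the memory
    and [Q k] is stable under extension. The conclusion has the shape of the body hypothesis, so the
    rule nests. *)
Lemma exec_For_extends V (Q : nat -> memory R -> Prop) x e c env st :
  (forall k m m', extends V m m' -> Q k m -> Q k m') ->
  (forall k st', (k < ieval env e)%N ->
     st'.1 0%N = st.1 0%N -> st'.1 6 = st.1 6 ->
     let st'' := exec c (bind env x k) st' in
     extends V st'.1 st''.1 /\ Q k st''.1) ->
  let st' := exec (For x e c) env st in
  extends V st.1 st'.1 /\ forall k, (k < ieval env e)%N -> Q k st'.1.
Proof.
move=> Qext body st'.
pose I k (m : memory R) := extends V st.1 m /\ forall k', (k' < k)%N -> Q k' m.
suff : I (ieval env e) st'.1 by [].
apply: (@exec_For_ind _ I) => // k s ke [[m0 m6 m1] mQ].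
have [ext Qk] := body k s ke m0 m6; split.
  case: ext => e0 e6 e1.
  by split=> [||p q /m1 /e1 //]; rewrite ?e0 ?e6.
move=> k'; rewrite ltnS leq_eqVlt => /predU1P[-> //|k'k].
exact: Qext ext (mQ _ k'k).
Qed.

Definition entry_value (N K : nat) (X w : nat -> nat -> R) (i j a b : nat) : R :=
  (i == j)%:R * ((a == b)%:R / (N * K)%:R) +
  (1 - (i == j))%:R * (w i 0%N * w j 0%N * X (i * K + a)%N (j * K + b)%N).

Definition fill_cmd : cmd :=
  For 2 (IVar 0) (For 3 (IVar 0) (For 4 (IVar 1) (For 5 (IVar 1) output_cmd))).

Lemma output_exec V env st :
  let: (i, j, a, b) := (env 2, env 3, env 4, env 5) in
  entry_value (env 0%N) (env 1%N) (st.1 0%N) (st.1 6) i j a b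
    = V (i * env 1 + a)%N (j * env 1 + b)%N ->
  let st' := exec output_cmd env st in
  extends V st.1 st'.1 /\
  st'.1 1%N (i * env 1 + a)%N (j * env 1 + b)%N
    = V (i * env 1 + a)%N (j * env 1 + b)%N.
Proof.
move=> EV st'.
pose p := (env 2 * env 1 + env 4)%N; pose q := (env 3 * env 1 + env 5)%N.
have stE p' q' : st'.1 1%N p' q' =
    if (p' == p) && (q' == q) then V p q else st.1 1%N p' q'.
  rewrite -EV /entry_value.
  rewrite -(kronE R env (IVar 2) (IVar 3)) -(kronE R env (IVar 4) (IVar 5)).
  (* The delta inside the natural subtraction [1 - (i == j)] is not yet cast to [R]; it is rewritten
     by injectivity of the cast. *)
  rewrite (_ : (env 2 == env 3) = ieval env (kron (IVar 2) (IVar 3)) :> nat) //.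
  by apply/eqP; rewrite -(eqr_nat R) kronE.
split; last by rewrite stE !eqxx.
split=> [||p' q' E]; try by rewrite exec_frame.
by rewrite stE; case: ifP => // /andP[/eqP -> /eqP ->].
Qed.

(** The predicates [Q4] to [Q1] quantify over one more loop index each and match the four nested
    loops from the inside out. Every write to a cell stores the value prescribed by [V], so the
    order of the writes is immaterial. *)
Lemma fill_exec V env st :
  let N := env 0%N in let K := env 1%N in
  (forall i j a b, (i < N)%N -> (j < N)%N -> (a < K)%N -> (b < K)%N ->
    entry_value N K (st.1 0%N) (st.1 6) i j a b = V (i * K + a)%N (j * K + b)%N) ->
  forall i j a b, (i < N)%N -> (j < N)%N -> (a < K)%N -> (b < K)%N ->
    (exec fill_cmd env st).1 1%N (i * K + a)%N (j * K + b)%N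
      = V (i * K + a)%N (j * K + b)%N.
Proof.
move=> N K EV.
pose Q4 i j a b (m : memory R) :=
  m 1%N (i * K + a)%N (j * K + b)%N = V (i * K + a)%N (j * K + b)%N.
pose Q3 i j a m := forall b, (b < K)%N -> Q4 i j a b m.
pose Q2 i j m := forall a, (a < K)%N -> Q3 i j a m.
pose Q1 i m := forall j, (j < N)%N -> Q2 i j m.
have X4 i j a b m m' : extends V m m' -> Q4 i j a b m -> Q4 i j a b m'.
  by case=> _ _; exact.
have X3 i j a m m' : extends V m m' -> Q3 i j a m -> Q3 i j a m'.
  by move=> e h b bK; exact: X4 e (h b bK).
have X2 i j m m' : extends V m m' -> Q2 i j m -> Q2 i j m'.
  by move=> e h a aK; exact: X3 e (h a aK).
have X1 i m m' : extends V m m' -> Q1 i m -> Q1 i m'.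
  by move=> e h j jN; exact: X2 e (h j jN).
suff [_ h] : extends V st.1 (exec fill_cmd env st).1 /\
    forall i, (i < N)%N -> Q1 i (exec fill_cmd env st).1.
  by move=> i j a b iN jN aK bK; exact: h.
apply: (exec_For_extends (X1)) => i s1 iN s10 s16.
apply: (exec_For_extends (X2 i)) => j s2 jN s20 s26.
apply: (exec_For_extends (X3 i j)) => a s3 aK s30 s36.
apply: (exec_For_extends (X4 i j a)) => b s4 bK s40 s46.
apply: output_exec.
by rewrite s40 s46 s30 s36 s20 s26 s10 s16; exact: EV.
Qed.
End RoundProgram.

(** * The program computes the rounding to a feasible point *)

Lemma Rank_addr N K (i : 'I_N) (a : 'I_K) :
  @tagnat.Rank N (fun=> K) i a = (i * K + a)%N :> nat.
Proof.
rewrite tagnat.RankEsum -(big_ord_widen _ (fun=> K)) ?(ltnW (ltn_ord i)) //.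
by rewrite big_const_ord iter_addn_0 mulnC.
Qed.

Lemma init_memE (R : realType) n (X : 'M[R]_n) (p q : 'I_n) :
  init_mem X 0%N p q = X p q.
Proof. by rewrite /init_mem !valK. Qed.

Lemma init_mem_block (R : realType) N K (X : 'BM[R]_(N, K)) (i j : 'I_N)
    (a b : 'I_K) :
  init_mem X 0%N (i * K + a)%N (j * K + b)%N = X^(i, j) a b.
Proof. by rewrite -!Rank_addr init_memE mxE. Qed.

Definition round_cmd : cmd := Seq (For 2 (IVar 0) block_cmd) fill_cmd.

Definition weights (R : realType) N K (X : 'BM[R]_(N, K)) (i : 'I_N) : R :=
  block_weight N K (init_mem X 0%N) i.

Lemma round_cmd_output (R : realType) N K (X : 'BM[R]_(N, K)) :
  output round_cmd X =
  round_blocks (weights X) (fun=> ((N * K)%:R^-1)%:M) X.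
Proof.
set Y := round_blocks _ _ _.
apply/mxblockP => i j; apply/matrixP => a b; rewrite 2!mxE !Rank_addr.
rewrite -init_mem_block.
pose st := exec (For 2 (IVar 0) block_cmd) (init_env N K) (init_mem X, 0%N).
have st0 : st.1 0%N = init_mem X 0%N by rewrite /st exec_frame.
have st6 (k : 'I_N) : st.1 6 k 0%N = weights X k by exact: weights_exec.
(* The target values are encoded as the array that would hold [Y] as an input matrix. *)
apply: (@fill_exec R (init_mem Y 0%N) (init_env N K) st) => // {i j a b}.
move=> k l a b kN lN aK bK; rewrite st0.
rewrite -[k]/(val (Ordinal kN)) -[l]/(val (Ordinal lN)).
rewrite -[a]/(val (Ordinal aK)) -[b]/(val (Ordinal bK)).
move: (Ordinal kN) (Ordinal lN) (Ordinal aK) (Ordinal bK) => {kN lN aK bK}.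
move=> {}k {}l {}a {}b; rewrite init_mem_block mxblockK /entry_value.
rewrite !st6 init_mem_block val_eqE.
case: eqVneq => [_|_].
  rewrite subnn mul0r addr0 mul1r mxE mulrb val_eqE.
  by case: eqP; rewrite ?mul1r ?mul0r.
by rewrite mul0r add0r mul1r [RHS]mxE.
Qed.

Lemma frobenius_norm_scale (R : rcfType) m n (c : R) (A : 'M[R]_(m, n)) :
  0 <= c -> frobenius_norm (c *: A) = c * frobenius_norm A.
Proof.
move=> c0; rewrite -{2}(ger0_norm c0) -sqrtr_sqr -sqrtrM ?sqr_ge0 //.
congr (Num.sqrt _); rewrite mulr_sumr; apply: eq_bigr => i _.
by rewrite mulr_sumr; apply: eq_bigr => j _; rewrite mxE exprMn.
Qed.

(** Writing [F] for the Frobenius norm of [n *: D], the search returns [w] with [F <= w <= 2 F].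
    Then [z = w / 2] satisfies [F <= 2 z] and [z <= F], and [F] is at most [n] times the nuclear
    norm of [D]. *)
Lemma weights_spec (R : realType) N K (X : 'BM[R]_(N, K)) i :
  let n : R := (N * K)%:R in
  let D := X^(i, i) - (n^-1)%:M in
  (0 < N)%N -> (0 < K)%N -> X^T = X ->
  exists z, [/\ weights X i = (1 + z)^-1, n * frobenius_norm D <= 2%:R * z &
    z <= n * nuclear_norm D].
Proof.
move=> n D N0 K0 Xs.
have n0 : 0 < n by rewrite ltr0n muln_gt0 N0.
have gapE (a b : 'I_K) : scaled_gap N K (init_mem X 0%N) i a b = (n *: D) a b.
  rewrite /scaled_gap init_mem_block [RHS]mxE [D a b]mxE mulrDr; congr (_ + _).
  by rewrite !mxE val_eqE mulrN mulrnAr mulfV ?(gt_eqF n0).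
have F2 : \sum_(a < K) \sum_(b < K)
    scaled_gap N K (init_mem X 0%N) i a b ^+ 2 = frobenius_norm (n *: D) ^+ 2.
  rewrite sqr_sqrtr; last first.
    by apply: sumr_ge0 => a _; apply: sumr_ge0 => b _; rewrite sqr_ge0.
  by apply: eq_bigr => a _; apply: eq_bigr => b _; rewrite gapE.
have S1 : \sum_(a < K) \sum_(b < K)
    `|scaled_gap N K (init_mem X 0%N) i a b| = \sum_a \sum_b `|(n *: D) a b|.
  by apply: eq_bigr => a _; apply: eq_bigr => b _; rewrite gapE.
have [FS SF] := sum_norm_le_frobenius (n *: D).
have := root_search K0 (frobenius_norm_ge0 _) FS SF.
rewrite /weights /block_weight F2 S1.
set w := iter _ _ _; rewrite -/w frobenius_norm_scale ?(ltW n0) //.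
move=> /andP[Fw wF].
have Ds : D^T = D by rewrite linearB /= tr_scalar_mx tr_submxblock Xs.
have := frobenius_le_nuclear Ds; rewrite -(ler_pM2l n0) => FN.
by exists (w / 2%:R); split => //; lra.
Qed.

Theorem theorem31 (R : realType) :
  (forall (N K : nat) (C : 'BM[R]_(N, K)) (beta delta : R)
          (Lambda : 'I_N -> 'M[R]_K),
     (0 < N)%N -> (0 < K)%N -> C^T = C -> 0 < beta ->
     (forall i, (Lambda i)^T = Lambda i) ->
     let X := gibbs C beta Lambda in
     \sum_(i < N) nuclear_norm (X^(i, i) - ((N * K)%:R^-1)%:M) <= delta ->
     `| \tr (C *m X) - opt_value C |
       <= (2 * K + 1)%:R * delta * block_norm C + beta^-1 * ln (N * K)%:R)
  /\
  (exists P : cmd,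
     poly_time R P /\
     forall (N K : nat) (C : 'BM[R]_(N, K)) (beta delta : R)
            (Lambda : 'I_N -> 'M[R]_K),
       (0 < N)%N -> (0 < K)%N -> C^T = C -> 0 < beta ->
       (forall i, (Lambda i)^T = Lambda i) ->
       let X := gibbs C beta Lambda in
       \sum_(i < N) nuclear_norm (X^(i, i) - ((N * K)%:R^-1)%:M) <= delta ->
       let X' := output P X in
       feasible X' /\
       \tr (C *m X') - opt_value C
         <= (4 * K + 2)%:R * delta * block_norm C + beta^-1 * ln (N * K)%:R).
Proof.
(* One [err] is paid for rounding [X] to the output and one for rounding a feasible point to the
   diagonal blocks of [X]; [ent] is the entropy term. *)
have main N K (C : 'BM[R]_(N, K)) (beta delta : R) (Lambda : 'I_N -> 'M[R]_K) :
    (0 < N)%N -> (0 < K)%N -> C^T = C -> 0 < beta ->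
    (forall i, (Lambda i)^T = Lambda i) ->
    let X := gibbs C beta Lambda in
    \sum_(i < N) nuclear_norm (X^(i, i) - ((N * K)%:R^-1)%:M) <= delta ->
    let X' := output round_cmd X in
    let err := (2 * K + 1)%:R * delta * block_norm C in
    let ent := beta^-1 * ln (N * K)%:R in
    [/\ feasible X', `|\tr (C *m X') - \tr (C *m X)| <= err,
      \tr (C *m X) - opt_value C <= err + ent,
      opt_value C <= \tr (C *m X') & 0 <= ent].
  move=> N0 K0 Cs b0 Ls X dX X' err ent.
  have Xp : psdmx X by exact: gibbs_psd.
  have err_ge : (2 * K + 1)%:R *
      (\sum_(i < N) nuclear_norm (X^(i, i) - ((N * K)%:R^-1)%:M))
      * block_norm C <= err.
    by rewrite ler_wpM2r ?block_norm_ge0 // ler_wpM2l.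
  have [X'f X'X] : feasible X' /\ `|\tr (C *m X') - \tr (C *m X)| <= err.
    rewrite /X' round_cmd_output.
    have [f c] := round_to_feasible N0 K0 Cs Xp
      (fun i => weights_spec i N0 K0 Xp.1).
    by split=> //; exact: le_trans c err_ge.
  (* An infimum is meaningful only for a nonempty set that is bounded below. [lb] gives the lower
     bound and the rounded point [X'] the nonemptiness. *)
  have lb : lbound [set \tr (C *m Y) | Y in [set Y | feasible Y]]%classic
      (\tr (C *m X) - (err + ent)).
    move=> _ [Y Yf <-].
    have := gibbs_le_feasible N0 K0 Cs b0 Ls Yf; rewrite -/X -/ent.
    by move: err_ge; lra.
  have X'in : [set \tr (C *m Y) | Y in [set Y | feasible Y]]%classic
      (\tr (C *m X')) by exists X'.
  split=> //.
  - by rewrite lerBlDl -lerBlDr; apply: lb_le_inf lb; exists (\tr (C *m X')).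
  - by apply: ge_inf X'in; exists (\tr (C *m X) - (err + ent)).
  - rewrite mulr_ge0 ?invr_ge0 ?(ltW b0) // ln_ge0 // ler1n muln_gt0 N0.
    exact: K0.
split=> [N K C beta delta Lambda N0 K0 Cs b0 Ls X dX|].
  have [_ X'X le1 le2 ent0] := main N K C beta delta Lambda N0 K0 Cs b0 Ls dX.
  (* The remaining side follows from [opt_value C <= \tr (C *m X') <= \tr (C *m X) + err] and
     [0 <= ent]. *)
  rewrite ler_norml le1 andbT lerNl opprB.
  by have := le_trans (ler_norm _) X'X; rewrite -/X in le2 *; lra.
exists round_cmd; split; first exact: poly_time_cmd.
move=> N K C beta delta Lambda N0 K0 Cs b0 Ls X dX X'.
have [X'f X'X le1 _ _] := main N K C beta delta Lambda N0 K0 Cs b0 Ls dX.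
(* Passing from [X] to [X'] costs a second [err], which doubles the factor [2 K + 1] but leaves the
   entropy term alone. *)
split=> //; rewrite (_ : (4 * K + 2)%N = 2 * (2 * K + 1))%N; last by lia.
have := le_trans (ler_norm _) X'X; rewrite -/X -/X' in le1 *.
rewrite natrM -!mulrA !mulrA; lra.
Qed.
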